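(* Let $(X,d)$ be a complete and separable metric space, let $\mathfrak m$ be a finite and positive Borel measure on $X$, let $p\in(1,+\infty)$, let $Y\subset X$ be a dense subset, and let $\mathscr A$ be a unital subalgebra of $\mathrm{Lip}_b(X)$ separating the points of $X$. For $y\in X$ write $d_y:x\mapsto d(x,y)$. If for every $y\in Y$ it holds $$d_y\in D^{1,p}(X,d,\mathfrak m;\mathscr A),\qquad |\mathrm D d_y|_{\star,\mathscr A}\le 1\quad \mathfrak m\text{-a.e. in }X,$$ then $\mathscr A$ is dense in $p$-energy.
   Context: $\mathrm{Lip}_b(X)$ is the algebra of bounded Lipschitz functions $f:X\to\mathbb R$. The asymptotic Lipschitz constant of $f\in \mathrm{Lip}_b(X)$ is $\mathrm{lip} f(x):=\lim_{r\downarrow 0}\mathrm{Lip}(f,B(x,r))=\limsup_{y,z\to x,\,y\ne z}\frac{|f(y)-f(z)|}{d(y,z)}$ (equal to $0$ at isolated points), where $\mathrm{Lip}(f,A)$ is the Lipschitz constant of $f$ on $A$. ''Unital and separating'' means: $1\in\mathscr A$ and for all $x_0\neq x_1$ in $X$ there is $f\in\mathscr A$ with $f(x_0)\ne f(x_1)$. $L^0(X,\mathfrak m)$ is the space of real $\mathfrak m$-measurable functions modulo $\mathfrak m$-a.e. equality. $G\in L^p(X,\mathfrak m)$ is a $(p,\mathscr A)$-relaxed gradient of $f\in L^0(X,\mathfrak m)$ if there exists a sequence $(f_n)_n\subset\mathscr A$ such that $f_n\to f$ in $\mathfrak m$-measure, $\mathrm{lip} f_n\rightharpoonup\tilde G$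 weakly in $L^p(X,\mathfrak m)$, and $\tilde G\le G$ $\mathfrak m$-a.e. If $f$ has a $(p,\mathscr A)$-relaxed gradient, $|\mathrm Df|_{\star,\mathscr A}$ denotes the one of minimal $L^p$-norm (minimal $(p,\mathscr A)$-relaxed gradient). $D^{1,p}(X,d,\mathfrak m;\mathscr A)$ is the set of $f\in L^0(X,\mathfrak m)$ having a $(p,\mathscr A)$-relaxed gradient. When $\mathscr A=\mathrm{Lip}_b(X)$ one speaks of $p$-relaxed gradients and writes $|\mathrm Df|_\star$. $\mathscr A$ is dense in $p$-energy if for every $f\in L^0(X,\mathfrak m)$ with a $p$-relaxed gradient there exists a sequence $f_n\in\mathscr A$ with $f_n\to f$ $\mathfrak m$-a.e. in $X$ and $\mathrm{lip} f_n\to|\mathrm Df|_\star$ strongly in $L^p(X,\mathfrak m)$. *)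

(* Defs.v *)
From HB Require Import structures.
From mathcomp Require Import all_boot all_order all_algebra.
From mathcomp Require Import all_classical all_reals all_analysis.

Set Implicit Arguments.
Unset Strict Implicit.
Unset Printing Implicit Defensive.
Import Order.TTheory GRing.Theory Num.Theory.
Import numFieldNormedType.Exports.

Local Open Scope classical_set_scope.
Local Open Scope ring_scope.

(* [Complete] bundles a base point, so these spaces are nonempty (as are all
   the measurable types of the library). *)
#[short(type="completeMetricType")]
HB.structure Definition CompleteMetric (K : numDomainType) :=
  {T of Metric K T & Complete T}.

Definition separable (T : topologicalType) :=
  exists D : set T, countable D /\ dense D.

(* The type X itself, equipped with its Borel sigma-algebra. *)
Notation borel X := (g_sigma_algebraType (@open X)).

Section lipschitz.
Context {R : realType} {X : metricType R}.
Implicit Types (f : X -> R) (A : set X) (x : X).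

(* Pairs with equal components contribute 0 / 0 = 0: for nonempty A this is the
   supremum over pairs of distinct points, read as 0 if there are none. *)
Definition Lip f A : \bar R :=
  ereal_sup [set (`|f yz.1 - f yz.2| / mdist yz.1 yz.2)%:E | yz in A `*` A].

Definition lip f x : R := fine (lim (Lip f (ball x r) @[r --> 0^'+])).

Definition Lip_b : set (X -> R) :=
  [set f | (exists M : R, forall x, `|f x| <= M) /\
           (exists L : R, forall x y, `|f x - f y| <= L * mdist x y)].

End lipschitz.

Section algebras.
Context {R : realType} {X : Type}.

Record unital_subalgebra (B A : set (X -> R)) : Prop := UnitalSubalgebra {
  unital_subalgebra_sub : A `<=` B ;
  unital_subalgebra1 : A (cst 1) ;
  unital_subalgebraD : forall f g, A f -> A g -> A (f \+ g) ;
  unital_subalgebraZ : forall (c : R) f, A f -> A (c \*: f) ;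
  unital_subalgebraM : forall f g, A f -> A g -> A (f \* g) }.

Definition separates_points (A : set (X -> R)) :=
  forall x0 x1, x0 <> x1 -> exists2 f, A f & f x0 <> f x1.

End algebras.

Section convergences.
Context {d : measure_display} {T : measurableType d} {R : realType}.
Variables (m : {measure set T -> \bar R}) (p : \bar R).

Definition cvg_in_measure (fn : nat -> T -> R) (f : T -> R) :=
  forall eps : R, 0 < eps ->
    m [set x | eps <= `|fn n x - f x|] @[n --> \oo] --> 0%E.

Definition cvg_Lp (gn : nat -> T -> R) (g : T -> R) :=
  [/\ forall n, gn n \in Lfun m p, g \in Lfun m p &
      'N[m]_p[EFin \o (gn n \- g)%R]%E @[n --> \oo] --> 0%E].

(* Continuous linear functionals on L^p; boundedness forces them to be constant
   on a.e.-classes, and their values outside L^p are irrelevant. *)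
Definition Lp_dual : set ((T -> R) -> R) :=
  [set phi |
    (forall (c : R) u v, u \in Lfun m p -> v \in Lfun m p ->
       phi ((c \*: u) \+ v) = c * phi u + phi v) /\
    (exists C : R, forall u, u \in Lfun m p ->
       (`|phi u|%:E <= C%:E * 'N[m]_p[EFin \o u])%E)].

Definition weak_cvg_Lp (gn : nat -> T -> R) (g : T -> R) :=
  [/\ forall n, gn n \in Lfun m p, g \in Lfun m p &
      forall phi, Lp_dual phi -> phi (gn n) @[n --> \oo] --> phi g].

End convergences.

(* Classes in L^0(X, m) and L^p(X, m) are represented by Borel functions; all
   the notions below only depend on the a.e.-classes of f and G. *)
Section relaxed_gradients.
Context {R : realType} {X : completeMetricType R}.
Variables (m : {measure set (borel X) -> \bar R}) (p : R) (A : set (X -> R)).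

Definition relaxed_gradient (f G : X -> R) :=
  G \in Lfun m p%:E /\
  exists (fn : nat -> X -> R) (G' : X -> R),
    [/\ forall n, A (fn n),
        cvg_in_measure m fn f,
        weak_cvg_Lp m p%:E (fun n => lip (fn n)) G' &
        {ae m, forall x, G' x <= G x}].

Definition D1p : set (X -> R) :=
  [set f | measurable_fun [set: borel X] (f : borel X -> R) /\
           exists G, relaxed_gradient f G].

Definition is_minimal_relaxed_gradient (f G : X -> R) :=
  relaxed_gradient f G /\
  forall H, relaxed_gradient f H ->
    ('N[m]_p%:E[EFin \o G] <= 'N[m]_p%:E[EFin \o H])%E.

(* Minimal relaxed gradients are unique only up to m-a.e. equality: this is a
   choice of representative. *)
Definition minimal_relaxed_gradient (f : X -> R) : X -> R :=
  xget (cst 0) [set G | is_minimal_relaxed_gradient f G].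

End relaxed_gradients.

Definition dense_in_energy (R : realType) (X : completeMetricType R)
    (m : {measure set (borel X) -> \bar R}) (p : R) (A : set (X -> R)) :=
  forall f : X -> R, D1p m p Lip_b f ->
    exists fn : nat -> X -> R,
      [/\ forall n, A (fn n),
          {ae m, forall x, fn n x @[n --> \oo] --> f x} &
          cvg_Lp m p%:E (fun n => lip (fn n))
            (minimal_relaxed_gradient m p Lip_b f)].

(* Main.v *)
Require Import Defs.
From mathcomp Require Import all_boot all_order all_algebra.
From mathcomp Require Import all_classical all_reals all_analysis.
From mathcomp Require polyrcf.
From mathcomp Require Import measurable_realfun ring lra.

Set Implicit Arguments.
Unset Strict Implicit.
Unset Printing Implicit Defensive.
Import Order.TTheory GRing.Theory Num.Theory.
Import numFieldNormedType.Exports.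

Local Open Scope classical_set_scope.
Local Open Scope ring_scope.

(** Why the theorem holds.

    Call [g] a relaxed slope of [f] if the pair [(f, g)] lies in the closure,
    for convergence in measure of the functions and L^p convergence of the
    slopes, of the pairs [(f', g')] with [f'] in [A] and [lip f' <= g'].  Both
    convergences are metrizable, so relaxed slopes pass to limits
    ([relaxed_slope_closed]) without diagonal sequences.

    Relaxed gradients, which are defined by weak convergence, are relaxed
    slopes ([relaxed_gradient_slope]): this is Mazur's lemma, applied to a tail
    of an a.e. convergent subsequence.  In the other direction, let [f_ n] in
    [A] tend to [f] with asymptotic Lipschitz constants of almost minimal norm.
    The midpoint of [f_ n] and [f_ k] is still close to [f], so the norm of its
    slope is almost minimal too, and uniform convexity of L^p makes
    [lip (f_ n)] a Cauchy sequence.  Hence a minimal slope exists, it is a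
    strong limit of constants [lip (f_ n)]
    ([minimal_slope_exists]), it is the minimal relaxed gradient
    ([minimal_relaxed_gradient_slope]), and it is unique
    ([minimal_slope_unique]).

    The heart of the matter is that [lip f] is a relaxed slope, with respect to
    [A], of every bounded Lipschitz function [f] ([relaxed_slope_Lip_b]).
    Relaxed slopes are local under minima: where [f1 < f2] the minimum takes
    the slope of [f1], where [f2 < f1] that of [f2] ([relaxed_slope_min]).
    Indeed [min f1 f2 = f1 - max (f1 - f2) 0], and [A] is an algebra, so one
    may replace the positive part by polynomials with derivative between 0
    and 1; the chain rule then bounds the slope by a convex combination of the
    two slopes, and the weights concentrate.  Starting from the distance
    functions, which have slope 1 by hypothesis, one controls the finite minima
    of [f (y_ i) + psi (mdist x (y_ i))], where [psi] is a maximum of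
    finitely many affine functions of slopes [k * dl].  They approximate
    the infimal convolution of [f] with [psi], as in the Hopf-Lax formula.  The
    breakpoints of [psi] grow geometrically, so that [psi s] is close to its
    slope at [s] times [s]; as an almost optimal [y] satisfies
    [psi (mdist x y) <= f x - f y] up to a small error, the slope of [psi] at
    [mdist x y] hardly exceeds a Lipschitz constant of [f] near [x]
    ([hopf_lax_slope]).  Shrinking the scale of [psi] and then [dl] gives
    [lip f].

    Consequently the minimal relaxed gradient of [f] with respect to bounded
    Lipschitz functions is also a relaxed slope with respect to [A]; by
    uniqueness it is the minimal one, so it is a strong limit of
    asymptotic Lipschitz constants of elements of [A]. *)

(** * The L^p norm on a finite measure space *)

Lemma powR_le_inv (R : realType) (p a b : R) : 0 < p -> 0 <= a -> 0 <= b ->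
  a `^ p <= b `^ p -> a <= b.
Proof.
move=> p0 a0 b0 ab; rewrite leNgt; apply/negP => ba.
by move: ab; rewrite leNgt gt0_ltr_powR ?nnegrE.
Qed.

Section Lp_norm.
Context d (T : measurableType d) (R : realType).
Variable mu : {finite_measure set T -> \bar R}.
Variables (p : R) (p_gt1 : 1 < p).
Implicit Types u v w : T -> R.

Definition Lpnorm (u : T -> R) : R := fine ('N[mu]_p%:E[EFin \o u])%E.

Local Notation Lp := (Lfun mu p%:E).
Local Notation N := Lpnorm.

Let p_ge1 : (1 <= p%:E)%E. Proof. by rewrite lee_fin ltW. Qed.
Let p_gt0 : 0 < p. Proof. exact: lt_trans p_gt1. Qed.

Lemma Lp_measurable u : u \in Lp -> measurable_fun [set: T] u.
Proof. by rewrite inE => /andP[/set_mem]. Qed.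

Lemma LpP u : u \in Lp <->
  measurable_fun [set: T] u /\ ('N[mu]_p%:E[EFin \o u] < +oo)%E.
Proof.
split; first by rewrite inE => /andP[/set_mem ? /set_mem].
by move=> [mu_ lu]; rewrite inE; apply/andP; split; apply/mem_set.
Qed.

Lemma LpnormE u : u \in Lp -> (N u)%:E = ('N[mu]_p%:E[EFin \o u])%E.
Proof. by move=> uL; rewrite -(Lfun_valP p_ge1 uL) finite_norm_fine. Qed.

Lemma Lpnorm_ge0 u : 0 <= N u.
Proof. by rewrite fine_ge0// Lnorm_ge0. Qed.

Lemma LpD u v : u \in Lp -> v \in Lp -> (u \+ v) \in Lp.
Proof. by move=> uL vL; have [_] := Lfun_addr_closed mu p_ge1; apply. Qed.

Lemma LpZ c u : u \in Lp -> (fun x => c * u x) \in Lp.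
Proof.
move=> uL; have [L0 /(_ c u 0 uL L0)] := Lfun_submod_closed mu p_ge1.
by rewrite addr0.
Qed.

Lemma LpnormD u v : u \in Lp -> v \in Lp -> N (u \+ v) <= N u + N v.
Proof.
move=> uL vL; rewrite -lee_fin EFinD !LpnormE ?LpD// eminkowski//;
  exact: Lp_measurable.
Qed.

Lemma LpnormZ c u : u \in Lp -> N (fun x => c * u x) = `|c| * N u.
Proof.
move=> uL; apply: EFin_inj; rewrite EFinM !LpnormE ?LpZ//.
by rewrite -(Lfun_valP p_ge1 uL) -LnormZ.
Qed.

Lemma Lp_le_ae u v : measurable_fun [set: T] u -> v \in Lp ->
  {ae mu, forall x, `|u x| <= `|v x|} -> u \in Lp.
Proof.
move=> um /LpP[vm vL] uv; apply/LpP; split => //; apply: le_lt_trans vL.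
rewrite unlock /= gt0_ler_poweR ?invr_ge0 ?(ltW p_gt0)//.
- by rewrite in_itv/= leey integral_ge0// => x _; rewrite lee_fin powR_ge0.
- by rewrite in_itv/= leey integral_ge0// => x _; rewrite lee_fin powR_ge0.
have mp w : measurable_fun [set: T] w ->
    measurable_fun [set: T] (EFin \o (fun x => `|w x| `^ p)).
  move=> wm; apply/measurable_EFinP.
  apply/(@measurableT_comp _ _ _ _ _ _ (@powR R ^~ p)) => //.
  exact: measurableT_comp.
apply: ae_ge0_le_integral => //; try exact: mp.
by apply: filterS uv => x uvx _; rewrite lee_fin ge0_ler_powR ?nnegrE// ltW.
Qed.

Lemma Lp_le u v : measurable_fun [set: T] u -> v \in Lp ->
  (forall x, `|u x| <= `|v x|) -> u \in Lp.
Proof. by move=> um vL uv; apply: Lp_le_ae vL _ => //; exact: aeW. Qed.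

Lemma integrable_powR_norm u : u \in Lp ->
  mu.-integrable setT (fun x => (`|u x| `^ p)%:E).
Proof. by move=> /Lfun_integrable; apply; exact: ltW. Qed.

Lemma powR_Lpnorm u : u \in Lp -> N u `^ p = (\int[mu]_x (`|u x| `^ p))%R.
Proof.
move=> uL; apply: EFin_inj; rewrite -poweR_EFin LpnormE// powR_Lnorm ?gt_eqF//.
rewrite /Rintegral fineK//.
exact/integrable_fin_num/integrable_powR_norm.
Qed.

Lemma Lpnorm_le_ae u v : u \in Lp -> v \in Lp ->
  {ae mu, forall x, `|u x| <= `|v x|} -> N u <= N v.
Proof.
move=> uL vL uv.
apply: (powR_le_inv p_gt0); rewrite ?Lpnorm_ge0//.
rewrite (powR_Lpnorm uL) (powR_Lpnorm vL).
have Ju := integrable_fin_num measurableT (integrable_powR_norm uL).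
have Jv := integrable_fin_num measurableT (integrable_powR_norm vL).
apply: (fine_le Ju Jv).
have mp w : w \in Lp -> measurable_fun [set: T] (EFin \o (fun x => `|w x| `^ p)).
  by move=> wL; have /measurable_int := integrable_powR_norm wL; apply.
apply: ae_ge0_le_integral => //; try exact: mp.
by apply: filterS uv => x uvx _; rewrite lee_fin ge0_ler_powR ?nnegrE// ltW.
Qed.

Lemma Lpnorm_le u v : measurable_fun [set: T] u -> v \in Lp ->
  (forall x, `|u x| <= `|v x|) -> N u <= N v.
Proof.
move=> um vL uv; apply: Lpnorm_le_ae => //; first exact: Lp_le uv.
exact: aeW.
Qed.

Lemma Lp_cst c : cst c \in Lp.
Proof. exact: Lfun_cst. Qed.

Lemma LpB u v : u \in Lp -> v \in Lp -> (u \- v) \in Lp.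
Proof.
move=> uL vL; rewrite (_ : u \- v = u \+ (fun x => -1 * v x)) ?LpD ?LpZ//.
by apply/funext => x /=; rewrite mulN1r.
Qed.

Lemma Lp_norm u : u \in Lp -> (fun x => `|u x|) \in Lp.
Proof.
move=> uL; apply: (@Lp_le _ u) => // [|x]; last by rewrite normr_id.
by apply: measurableT_comp => //; exact: Lp_measurable.
Qed.

Lemma Lp_max u v : u \in Lp -> v \in Lp -> (fun x => Num.max (u x) (v x)) \in Lp.
Proof.
move=> uL vL; apply: (Lp_le _ (LpD (Lp_norm uL) (Lp_norm vL))).
  by apply: measurable_maxr; exact: Lp_measurable.
move=> x /=; rewrite [leRHS]ger0_norm ?addr_ge0// /Num.max.
by case: ltP => _; rewrite ?lerDr ?lerDl.
Qed.

Lemma LpnormB u v : u \in Lp -> v \in Lp -> N (u \- v) = N (v \- u).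
Proof.
move=> uL vL; rewrite (_ : u \- v = (fun x => -1 * (v \- u) x)) ?LpnormZ ?LpB//.
  by rewrite normrN1 mul1r.
by apply/funext => x /=; rewrite mulN1r opprB.
Qed.

Lemma Lpnorm_triangle v u w : u \in Lp -> v \in Lp -> w \in Lp ->
  N (u \- w) <= N (u \- v) + N (v \- w).
Proof.
move=> uL vL wL; rewrite (_ : u \- w = (u \- v) \+ (v \- w)).
  by apply: LpnormD; exact: LpB.
by apply/funext => x /=; rewrite addrA subrK.
Qed.

Lemma Lpnorm_le_add u v : u \in Lp -> v \in Lp -> N u <= N v + N (u \- v).
Proof.
move=> uL vL; rewrite [leLHS](_ : _ = N (v \+ (u \- v))).
  by apply: LpnormD => //; exact: LpB.
by congr N; apply/funext => x /=; rewrite addrC subrK.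
Qed.

Lemma Lpnorm_eq0 u : u \in Lp -> N u = 0 -> {ae mu, forall x, u x = 0}.
Proof.
move=> uL; rewrite -(Lfun_valP p_ge1 uL) => /fine_Lnormr_eq0.
by apply: filterS => x; apply.
Qed.

Lemma Lpnorm_lt_powR u e : 0 < e -> N u `^ p < e `^ p -> N u < e.
Proof.
move=> e0 uep; rewrite ltNge; apply/negP => eu.
by move: uep; rewrite ltNge ge0_ler_powR ?nnegrE ?Lpnorm_ge0// ltW.
Qed.

Lemma powR_root e : 0 < e -> (e `^ p^-1) `^ p = e.
Proof. by move=> e0; rewrite -powRrM mulVf ?gt_eqF// powRr1// ltW. Qed.

Lemma Lpnorm_dominated_cvg (u_ : (T -> R)^nat) (u h : T -> R) :
  (forall n, measurable_fun [set: T] (u_ n)) -> measurable_fun setT u -> h \in Lp ->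
  (forall n x, `|u_ n x| <= h x) ->
  {ae mu, forall x, u_ n x @[n --> \oo] --> u x} ->
  u \in Lp /\ N (u_ n \- u) @[n --> \oo] --> 0.
Proof.
move=> um_ um hL uh ucvg.
have uhae : {ae mu, forall x, `|u x| <= h x}.
  apply: filterS ucvg => x ux.
  have nux : `|u_ n x| @[n --> \oo] --> `|u x| by exact: cvg_norm ux.
  rewrite -(cvg_lim _ nux)//.
  by apply: limr_le; [exact: cvgP nux|exact: nearW].
have h0 x : 0 <= h x by exact: le_trans (uh 0%N x).
have uL : u \in Lp.
  apply: Lp_le_ae hL _ => //; apply: filterS uhae => x.
  by rewrite (ger0_norm (h0 x)).
have uL_ n : u_ n \in Lp.
  by apply: Lp_le hL _ => // x; rewrite (ger0_norm (h0 x)).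
split => //.
have hhL : (fun x => 2 * h x) \in Lp by exact: LpZ.
have [_ _ J] : [/\ mu.-integrable setT (cst 0%E),
    [sequence \int[mu]_x `|(`|(u_ n \- u) x| `^ p)%:E - 0|]_n @ \oo --> 0%E &
    [sequence \int[mu]_x (`|(u_ n \- u) x| `^ p)%:E]_n @ \oo
       --> \int[mu]_x (cst 0 x)]%E.
  apply: (@dominated_convergence _ _ _ mu setT measurableT _ _
    (fun x => (`|(fun x => 2 * h x) x| `^ p)%:E)).
  - by move=> n; have /measurable_int := integrable_powR_norm (LpB (uL_ n) uL);
      apply.
  - exact: measurable_cst.
  - apply: filterS ucvg => x ux _.
    apply/fine_cvgP; split; first exact: nearW.
    apply/cvgr0Pnorm_lt => e e0.
    have /cvgrPdist_lt/(_ (e `^ p^-1)) := ux.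
    rewrite powR_gt0// => /(_ isT); apply: filterS => n /= un.
    rewrite ger0_norm ?powR_ge0// -[ltRHS](powR_root e0).
    by rewrite gt0_ltr_powR ?nnegrE// ?powR_ge0// distrC.
  - exact: integrable_powR_norm.
  - apply: filterS uhae => x ux n _.
    rewrite gee0_abs ?lee_fin ?powR_ge0// ge0_ler_powR ?nnegrE ?(ltW p_gt0)//=.
    rewrite [leRHS]ger0_norm ?mulr_ge0// (le_trans (ler_normB _ _))//.
    by rewrite mulr_natl mulr2n lerD.
apply/cvgr0Pnorm_lt => e e0.
move: J; rewrite integral0 => /fine_cvgP[_] /cvgr0Pnorm_lt/(_ (e `^ p)).
rewrite powR_gt0// => /(_ isT); apply: filterS => n /= Jn.
rewrite ger0_norm ?Lpnorm_ge0//; apply: Lpnorm_lt_powR => //.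
rewrite powR_Lpnorm ?LpB//; apply: le_lt_trans Jn.
exact: ler_norm.
Qed.

End Lp_norm.

(** * Uniform convexity of L^p *)

Section powR_convexity.
Context {R : realType}.
Implicit Types p x y a b : R.

Lemma powR_homo p x y : 0 <= p -> 0 <= x -> x <= y -> x `^ p <= y `^ p.
Proof.
by move=> p0 x0 xy; rewrite ge0_ler_powR ?nnegrE//; exact: le_trans xy.
Qed.

(** Young's inequality for the conjugate exponents [p] and [p / (p - 1)], read
    as the position of a convex graph above its tangents. *)
Lemma powR_tangent p x y : 1 < p -> 0 <= x -> 0 <= y ->
  y `^ p + p * y `^ (p - 1) * (x - y) <= x `^ p.
Proof.
move=> p1 x0 y0; have p0 : 0 < p by exact: lt_trans p1.
have pB1 : 0 < p - 1 by rewrite subr_gt0.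
have pN0 : p != 0 by rewrite gt_eqF.
have pBN0 : p - 1 != 0 by rewrite gt_eqF.
have conj : p^-1 + (p / (p - 1))^-1 = 1 by field; apply/andP.
have := conjugate_powR x0 (powR_ge0 y (p - 1)) p0 (divr_gt0 p0 pB1) conj.
rewrite -powRrM mulrCA mulfV// mulr1 => young.
have -> : y `^ p + p * y `^ (p - 1) * (x - y) =
    p * (x * y `^ (p - 1)) - (p - 1) * y `^ p.
  by rewrite -(mulr_powRB1 y0 p0); ring.
rewrite lerBlDr; apply: le_trans (ler_wpM2l (ltW p0) young) _.
by rewrite le_eqVlt; apply/orP; left; apply/eqP; field; apply/andP.
Qed.

Lemma powR_lipschitz p M a b : 1 < p -> 0 <= a -> 0 <= b -> a <= M -> b <= M ->
  `|a `^ p - b `^ p| <= p * M `^ (p - 1) * `|a - b|.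
Proof.
move=> p1; have pB0 : 0 <= p - 1 by rewrite subr_ge0 ltW.
have p0 : 0 <= p by rewrite ltW// (lt_trans _ p1).
wlog ab : a b / b <= a => [hwlog|] a0 b0 aM bM.
  have [ba|/ltW ab] := leP b a; first exact: hwlog.
  by rewrite distrC (distrC a); exact: hwlog.
rewrite !ger0_norm ?subr_ge0//; last by apply: powR_homo.
apply: (@le_trans _ _ (p * a `^ (p - 1) * (a - b))).
  have := powR_tangent p1 b0 a0.
  have -> : p * a `^ (p - 1) * (b - a) = - (p * a `^ (p - 1) * (a - b)) by ring.
  by rewrite lerBlDr -lerBlDl.
by rewrite ler_wpM2r ?subr_ge0// ler_wpM2l//; exact: powR_homo.
Qed.

Lemma cvg_powR p (u_ : R^nat) (l : R) : 1 < p -> (forall n, 0 <= u_ n) ->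
  u_ n @[n --> \oo] --> l -> u_ n `^ p @[n --> \oo] --> l `^ p.
Proof.
move=> p1 u0 ul; have p0 : 0 < p by exact: lt_trans p1.
have l0 : 0 <= l.
  by rewrite -(cvg_lim _ ul)//; apply: limr_ge; [exact: cvgP ul|exact: nearW].
have C0 : 0 < p * (l + 1) `^ (p - 1) by rewrite mulr_gt0// powR_gt0// ltr_wpDl.
apply/cvgrPdist_lt => e e0.
have /cvgrPdist_lt := ul.
move=> /(_ (Num.min 1 (e / (p * (l + 1) `^ (p - 1))))).
rewrite lt_min ltr01 divr_gt0// => /(_ isT); apply: filterS => n.
rewrite lt_min => /andP[lu1 lue].
have uM : u_ n <= l + 1.
  by move: lu1; rewrite ltr_norml => /andP[]; lra.
apply: (le_lt_trans (powR_lipschitz p1 l0 (u0 n) _ uM)); first by rewrite lerDl.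
by rewrite mulrC -ltr_pdivlMr.
Qed.

(** With [m] the midpoint and [h = (a - b) / 4], add the tangent inequalities
    for [b] at [m], for [m + h] at [m] and for [a] at [m + h]: only the
    increase of the derivative between [m] and [m + h] survives. *)
Lemma powR_midpoint_deficit p a b : 1 < p -> 0 <= b -> b <= a ->
  p * (a - b) / 8 *
    (((a + b) / 2 + (a - b) / 4) `^ (p - 1) - ((a + b) / 2) `^ (p - 1)) <=
  (a `^ p + b `^ p) / 2 - ((a + b) / 2) `^ p.
Proof.
move=> p1 b0 ba; set m := (a + b) / 2; set h := (a - b) / 4.
have h0 : 0 <= h by rewrite divr_ge0// subr_ge0.
have m0 : 0 <= m by rewrite divr_ge0// addr_ge0// (le_trans b0).
have t1 := @powR_tangent p a (m + h) p1 (le_trans b0 ba) (addr_ge0 m0 h0).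
have t2 := @powR_tangent p (m + h) m p1 (addr_ge0 m0 h0) m0.
have t3 := @powR_tangent p b m p1 b0 m0.
have e1 : a - (m + h) = h by rewrite /m /h; field.
have e2 : m + h - m = h by ring.
have e3 : b - m = - (2 * h) by rewrite /m /h; field.
have e4 : p * (a - b) / 8 = p * h / 2 by rewrite /h; field.
rewrite e1 in t1; rewrite e2 in t2; rewrite e3 in t3; rewrite e4.
set A := a `^ p in t1 *; set B := b `^ p in t3 *; set M := m `^ p in t2 t3 *.
set H := (m + h) `^ p in t1 t2; set H1 := (m + h) `^ (p - 1) in t1 *.
set M1 := m `^ (p - 1) in t2 t3 *.
have -> : p * h / 2 * (H1 - M1) = (p * H1 * h - p * M1 * h) / 2 by ring.
have e5 : p * M1 * - (2 * h) = - (2 * (p * M1 * h)) by ring.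
rewrite e5 in t3.
lra.
Qed.

(** A homogeneous form of strict convexity that serves all exponents [p > 1] at
    once: if [a] and [b] are relatively close the first term is enough,
    otherwise the midpoint deficit is comparable to the larger of [a `^ p] and
    [b `^ p]. *)
Lemma powR_unif_convex p eta : 1 < p -> 0 < eta -> exists2 C, 0 < C &
  forall a b, 0 <= a -> 0 <= b ->
  `|a - b| `^ p <= eta * (a `^ p + b `^ p) +
                   C * ((a `^ p + b `^ p) / 2 - ((a + b) / 2) `^ p).
Proof.
move=> p1 eta0; have p0 : 0 < p by exact: lt_trans p1.
have pB1 : 0 < p - 1 by rewrite subr_gt0.
pose s := eta `^ p^-1; have s0 : 0 < s by rewrite powR_gt0.
have sp : s `^ p = eta by rewrite -powRrM mulVf ?gt_eqF// powRr1// ltW.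
pose k := (1 + s / 4) `^ (p - 1) - 1.
have k0 : 0 < k.
  rewrite subr_gt0 -[ltLHS](@powRr0 _ (1 + s / 4)).
  have s1 : 1 < 1 + s / 4 by rewrite ltrDl divr_gt0.
  by rewrite /powR !gt_eqF ?(lt_trans _ s1)// ltr_expR ltr_pM2r ?ln_gt0.
pose c := p * s / 8 * ((2^-1) `^ (p - 1) * k).
have c0 : 0 < c by rewrite /c !mulr_gt0 ?powR_gt0 ?invr_gt0.
exists c^-1; first by rewrite invr_gt0.
suff main a b : 0 <= b -> b <= a -> `|a - b| `^ p <= eta * (a `^ p + b `^ p) +
                   c^-1 * ((a `^ p + b `^ p) / 2 - ((a + b) / 2) `^ p).
  move=> a b a0 b0; have [ba|/ltW ab] := leP b a; first exact: main.
  by rewrite distrC (addrC (a `^ p)) (addrC a); exact: main.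
move=> b0 ba; have a0 : 0 <= a by exact: le_trans ba.
have ab0 : 0 <= a - b by rewrite subr_ge0.
rewrite ger0_norm//.
have apb : 0 <= a + b by exact: addr_ge0.
have m0 : 0 <= (a + b) / 2 by rewrite divr_ge0// addr_ge0.
have m2 : a / 2 <= (a + b) / 2 by rewrite ler_pM2r ?invr_gt0// lerDl.
have ma : (a + b) / 2 <= a by rewrite ler_pdivrMr// mulr_natr mulr2n lerD2l.
have D := @powR_midpoint_deficit p a b p1 b0 ba.
have [abs|abs] := leP (a - b) (s * a).
  apply: (@le_trans _ _ (eta * a `^ p)).
    rewrite -sp -powRM ?(ltW s0)//.
    by rewrite ge0_ler_powR ?nnegrE ?(ltW p0)// mulr_ge0// ltW.
  apply: (@le_trans _ _ (eta * (a `^ p + b `^ p))).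
    by rewrite ler_pM2l// lerDl powR_ge0.
  rewrite lerDl mulr_ge0 ?invr_ge0 ?(ltW c0)//; apply: le_trans D.
  rewrite mulr_ge0 ?divr_ge0 ?mulr_ge0 ?(ltW p0)// subr_ge0.
  by apply: powR_homo; rewrite ?(ltW pB1)// lerDl divr_ge0.
apply: (@le_trans _ _ (a `^ p)).
  by apply: powR_homo; rewrite ?(ltW p0)// gerBl.
apply: (@le_trans _ _ (c^-1 * ((a `^ p + b `^ p) / 2 - ((a + b) / 2) `^ p)));
  last by rewrite lerDr mulr_ge0 ?(ltW eta0)// addr_ge0 ?powR_ge0.
rewrite ler_pdivlMl//; apply: le_trans D.
have -> : c * a `^ p = (p * (s * a) / 8) * ((a / 2) `^ (p - 1) * k).
  by rewrite powRM ?invr_ge0// -(mulr_powRB1 a0 p0) /c; ring.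
apply: ler_pM.
- by rewrite divr_ge0// !mulr_ge0 ?(ltW p0) ?(ltW s0).
- by rewrite mulr_ge0 ?powR_ge0 ?(ltW k0).
- by rewrite ler_pM2r ?invr_gt0// ler_pM2l// ltW.
apply: (@le_trans _ _ (((a + b) / 2) `^ (p - 1) * k)).
  by rewrite ler_pM2r//; apply: powR_homo; rewrite ?(ltW pB1)// divr_ge0.
rewrite /k mulrBr mulr1 lerD2r -powRM ?addr_ge0 ?divr_ge0 ?(ltW s0)//.
apply: powR_homo; first exact: ltW.
  by rewrite mulr_ge0// addr_ge0// divr_ge0// ltW.
rewrite mulrDr mulr1 lerD2l mulrA ler_pM2r ?invr_gt0//.
apply: le_trans (ltW abs); rewrite mulrC ler_pM2l//.
Qed.

End powR_convexity.

Section Lp_unif_convex.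
Context d (T : measurableType d) (R : realType).
Variable mu : {finite_measure set T -> \bar R}.
Variables (p : R) (p_gt1 : 1 < p).
Implicit Types u v w : T -> R.
Local Notation Lp := (Lfun mu p%:E).
Local Notation N := (Lpnorm mu p).

Let p_gt0 : 0 < p. Proof. exact: lt_trans p_gt1. Qed.

Lemma Lpnorm_midpoint_powR eta : 0 < eta -> exists2 C, 0 < C &
  forall u v, u \in Lp -> v \in Lp ->
    (forall x, 0 <= u x) -> (forall x, 0 <= v x) ->
  N (u \- v) `^ p <= eta * (N u `^ p + N v `^ p) +
    C * ((N u `^ p + N v `^ p) / 2 - N (fun x => 2^-1 * (u \+ v) x) `^ p).
Proof.
move=> eta0; have [C C0 pointwise] := powR_unif_convex p_gt1 eta0.
exists C => // u v uL vL u0 v0.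
have mL : (fun x => 2^-1 * (u \+ v) x) \in Lp by apply: LpZ => //; exact: LpD.
have dL : (u \- v) \in Lp by exact: LpB.
have I w : w \in Lp -> mu.-integrable setT (EFin \o (fun x => `|w x| `^ p)).
  exact: integrable_powR_norm.
have IZ c f : mu.-integrable setT (EFin \o f) ->
    mu.-integrable setT (EFin \o (fun x => c * f x)).
  by move=> If; exact: (integrableZl measurableT c If).
have ID f g : mu.-integrable setT (EFin \o f) ->
    mu.-integrable setT (EFin \o g) ->
    mu.-integrable setT (EFin \o (fun x => f x + g x)).
  by move=> If Ig; exact: (integrableD measurableT If Ig).
have IB f g : mu.-integrable setT (EFin \o f) ->
    mu.-integrable setT (EFin \o g) ->
    mu.-integrable setT (EFin \o (fun x => f x - g x)).
  by move=> If Ig; exact: (integrableB measurableT If Ig).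
rewrite !powR_Lpnorm//.
rewrite [leRHS](_ : _ = \int[mu]_x
   ((eta + C / 2) * (`|u x| `^ p + `|v x| `^ p)
     - C * `|2^-1 * (u \+ v) x| `^ p)); last first.
  rewrite RintegralB//; last 2 first.
    by apply/IZ/ID; exact: I.
    exact/IZ/I.
  rewrite RintegralZl//; last by apply: ID; exact: I.
  rewrite RintegralZl; [|by []|exact: I].
  rewrite RintegralD; [|by []|exact: I|exact: I].
  move: (Rintegral _ _ _) (Rintegral _ _ _) (Rintegral _ _ _) => a b c.
  by ring.
apply: le_Rintegral => //; first exact: I.
  by apply: IB; [apply/IZ/ID; exact: I|exact/IZ/I].
move=> x _ /=; have := pointwise _ _ (u0 x) (v0 x).
rewrite (ger0_norm (u0 x)) (ger0_norm (v0 x)).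
rewrite (ger0_norm (_ : 0 <= 2^-1 * (u x + v x))) ?mulr_ge0 ?addr_ge0//.
rewrite (mulrC 2^-1); lra.
Qed.

(** In the integrated inequality, [eta] absorbs half of [e `^ p]; the deficit
    absorbs the other half because the [p]-th powers of [K + dl] and [K - dl]
    differ by [O(dl)], by the tangent inequality. *)
Lemma Lp_unif_convex K e : 0 <= K -> 0 < e -> exists2 dl, 0 < dl &
  forall u v, u \in Lp -> v \in Lp ->
    (forall x, 0 <= u x) -> (forall x, 0 <= v x) ->
    N u <= K + dl -> N v <= K + dl ->
    K - dl <= N (fun x => 2^-1 * (u \+ v) x) -> N (u \- v) <= e.
Proof.
move=> K0 e0.
have K1 : 0 < (K + 1) `^ p by rewrite powR_gt0// ltr_wpDl.
have K1' : 0 < (K + 1) `^ (p - 1) by rewrite powR_gt0// ltr_wpDl.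
have ep : 0 < e `^ p by rewrite powR_gt0.
pose eta := e `^ p / 4 / (K + 1) `^ p.
have eta0 : 0 < eta by rewrite !divr_gt0.
have [C C0 J] := Lpnorm_midpoint_powR eta0.
pose D := C * (2 * (p * (K + 1) `^ (p - 1))).
have D0 : 0 < D by rewrite !mulr_gt0.
pose dl := Num.min 1 (e `^ p / 2 / D).
have dl0 : 0 < dl by rewrite lt_min ltr01 !divr_gt0.
have dl1 : dl <= 1 by rewrite ge_min lexx.
have dlD : D * dl <= e `^ p / 2.
  by rewrite -ler_pdivlMl// mulrC ge_min lexx orbT.
exists dl => // u v uL vL u0 v0 uK vK mK.
set m := fun x => _ in mK *.
rewrite leNgt; apply/negP => eN.
have : e `^ p < N (u \- v) `^ p.
  by rewrite gt0_ltr_powR ?nnegrE ?Lpnorm_ge0// ltW.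
rewrite ltNge => /negP; apply; apply: le_trans (J _ _ uL vL u0 v0) _.
rewrite -/m.
have Kd0 : 0 <= K + dl by rewrite addr_ge0// ltW.
have uKp : N u `^ p <= (K + dl) `^ p.
  by apply: powR_homo; rewrite ?Lpnorm_ge0 ?(ltW p_gt0).
have vKp : N v `^ p <= (K + dl) `^ p.
  by apply: powR_homo; rewrite ?Lpnorm_ge0 ?(ltW p_gt0).
have tang := powR_tangent p_gt1 (Lpnorm_ge0 mu p m) Kd0.
have Kd1 : (K + dl) `^ p <= (K + 1) `^ p.
  by apply: powR_homo; rewrite ?(ltW p_gt0) ?lerD2l.
have Kd1' : (K + dl) `^ (p - 1) <= (K + 1) `^ (p - 1).
  by apply: powR_homo; rewrite ?lerD2l// subr_ge0 ltW.
have A : (K + dl) `^ p - N m `^ p <= 2 * (p * (K + 1) `^ (p - 1)) * dl.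
  have : p * (K + dl) `^ (p - 1) * (K + dl - N m) <=
         p * (K + 1) `^ (p - 1) * (2 * dl).
    apply: (@le_trans _ _ (p * (K + dl) `^ (p - 1) * (2 * dl))).
      by rewrite ler_wpM2l ?mulr_ge0 ?powR_ge0 ?(ltW p_gt0)//; lra.
    by rewrite ler_wpM2r ?mulr_ge0 ?(ltW dl0)// ler_wpM2l ?(ltW p_gt0).
  have -> : p * (K + dl) `^ (p - 1) * (K + dl - N m) =
      - (p * (K + dl) `^ (p - 1) * (N m - (K + dl))) by ring.
  have -> : p * (K + 1) `^ (p - 1) * (2 * dl) =
    2 * (p * (K + 1) `^ (p - 1)) * dl by ring.
  by move=> ?; rewrite lerBlDr -lerBlDl; apply: le_trans tang; lra.
have B : eta * (N u `^ p + N v `^ p) <= e `^ p / 2.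
  apply: (@le_trans _ _ (eta * (2 * (K + 1) `^ p))).
    by rewrite ler_wpM2l ?(ltW eta0)//; lra.
  rewrite le_eqVlt; apply/orP; left; apply/eqP; rewrite /eta; field.
  by rewrite gt_eqF.
have E : C * ((N u `^ p + N v `^ p) / 2 - N m `^ p) <= e `^ p / 2.
  apply: le_trans dlD; rewrite /D -mulrA ler_pM2l//; lra.
lra.
Qed.

End Lp_unif_convex.

(** * Almost everywhere convergence and completeness of L^p *)

Section half_expn.
Context {R : realType}.

Lemma half_expn_gt0 k : 0 < 2^-1 ^+ k :> R.
Proof. by rewrite exprn_gt0// invr_gt0. Qed.

Lemma cvg_half_expn : 2^-1 ^+ n @[n --> \oo] --> (0 : R).
Proof.
have -> : (fun n => 2^-1 ^+ n : R) = geometric 1 2^-1.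
  by apply/funext => n; rewrite /= mul1r.
by apply: cvg_geometric; rewrite ger0_norm ?invr_ge0// invf_lt1 ?ltr1n.
Qed.

Lemma half_expn_le (e : R) : 0 < e ->
  exists k, forall n, (k <= n)%N -> 2^-1 ^+ n <= e.
Proof.
move=> e0; have /cvgr0Pnorm_le/(_ e e0)[k _ ke] := cvg_half_expn.
by exists k => n /ke; apply: le_trans; exact: ler_norm.
Qed.

End half_expn.

Section ae_convergence.
Context d (T : measurableType d) (R : realType).
Variable mu : {measure set T -> \bar R}.

Lemma ae_cvg_measurable (w_ : (T -> R)^nat) :
  (forall n, measurable_fun setT (w_ n)) ->
  {ae mu, forall x, cvgn (w_ ^~ x)} ->
  exists2 w : T -> R, measurable_fun setT w &
    {ae mu, forall x, w_ n x @[n --> \oo] --> w x}.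
Proof.
move=> wm [B [mB B0 cB]].
pose w' n : T -> R := (w_ n) \_ (~` B).
have w'm n : measurable_fun setT (w' n).
  apply/(measurable_restrictT _ (measurableC mB)).
  exact: measurable_funS (wm n).
have w'B x : ~ B x -> w' ^~ x = w_ ^~ x.
  by move=> Bx; apply/funext => n; rewrite /w' patchE mem_set.
exists (fun x => limn (w' ^~ x)).
  apply: (measurable_fun_cvg w'm) => x _.
  have [xB|xB] := pselect (B x).
    have -> : w' ^~ x = cst 0.
      by apply/funext => n; rewrite /w' patchE memNset//= => /(_ xB).
    by rewrite lim_cst//; exact: cvg_cst.
  rewrite w'B//; apply: contrapT => ncvg; apply: xB; apply: cB => /=.
  by move=> /cvgP; apply: contra_not ncvg => wx; exact: wx.
exists B; split => // x /= ncvg; apply: contrapT => xB; apply: ncvg.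
rewrite w'B//; apply: contrapT => ncvg; apply: xB; apply: cB => /= wx.
exact: ncvg.
Qed.

(** The series of absolute values has a finite integral, hence a finite sum
    almost everywhere. *)
Lemma ae_cvg_series (v_ : (T -> R)^nat) (c : R) : 0 <= c ->
  (forall k, measurable_fun setT (v_ k)) ->
  (forall k, \int[mu]_x `|v_ k x|%:E <= (c * 2^-1 ^+ k)%:E)%E ->
  {ae mu, forall x, cvgn (series (v_ ^~ x))}.
Proof.
move=> c0 vm vint.
pose V k : T -> \bar R := EFin \o (fun y => `|v_ k y|).
have Vm k : measurable_fun [set: T] (V k).
  by apply/measurable_EFinP; exact: measurableT_comp.
have V0 k x : (0 <= V k x)%E by rewrite lee_fin.
pose S x := (\sum_(k <oo) V k x)%E.
have S0 x : (0 <= S x)%E by apply: nneseries_ge0 => k _ _.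
have Sint : mu.-integrable setT S.
  apply/integrableP; split; first exact: ge0_emeasurable_sum.
  rewrite (eq_integral S); last by move=> x _; rewrite gee0_abs.
  rewrite integral_nneseries//.
  apply: (@le_lt_trans _ _ (c * (1 - 2^-1)^-1)%:E); last exact: ltry.
  apply: lime_le.
    by apply: is_cvg_nneseries => k _ _; exact: integral_ge0.
  apply: nearW => n.
  apply: (@le_trans _ _ (\sum_(0 <= k < n) (c * 2^-1 ^+ k)%:E)%E).
    by apply: lee_sum => k _; exact: vint.
  rewrite sumEFin lee_fin.
  apply: (@geometric_le_lim _ n c 2^-1) => //.
  by rewrite ger0_norm ?invr_ge0// invf_lt1 ?ltr1n.
have := integrable_ae measurableT Sint; apply: filterS => x /(_ I) Sx.
apply: normed_cvg; apply: nondecreasing_is_cvgn.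
  apply: nondecreasing_series => k _ _ /=; exact: normr_ge0.
exists (fine (S x)) => _ [n _ <-].
rewrite -lee_fin fineK// /normed_series_of /series/= -sumEFin.
by apply: nneseries_lim_ge => k _ _; rewrite lee_fin.
Qed.

End ae_convergence.

Section Lp_complete.
Context d (T : measurableType d) (R : realType).
Variable mu : {finite_measure set T -> \bar R}.
Variables (p : R) (p_gt1 : 1 < p).
Implicit Types u v w : T -> R.
Local Notation Lp := (Lfun mu p%:E).
Local Notation N := (Lpnorm mu p).

Let p_gt0 : 0 < p. Proof. exact: lt_trans p_gt1. Qed.

Lemma integral_norm_le_Lpnorm : exists2 C, 0 <= C &
  forall u, u \in Lp -> (\int[mu]_x `|u x|%:E <= (C * N u)%:E)%E.
Proof.
pose q := p / (p - 1).
have q0 : 0 < q by rewrite divr_gt0// subr_gt0.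
have conj : p^-1 + q^-1 = 1.
  by rewrite /q; field; rewrite !gt_eqF// subr_gt0.
have L1 : ('N[mu]_q%:E[EFin \o cst (1:R)%R])%E \is a fin_num.
  rewrite Lnorm_cst1 fin_num_poweR//; exact: fin_num_measure.
exists (fine ('N[mu]_q%:E[EFin \o cst (1:R)%R])%E).
  by rewrite fine_ge0// Lnorm_ge0.
move=> u uL; have um := Lp_measurable uL.
have := hoelder mu um (measurable_cst (1 : R)) p_gt0 q0 conj.
rewrite [X in _ -> (_ <= X)%E]EFinM (LpnormE p_gt1 uL) fineK// muleC Lnorm1.
by under eq_integral do rewrite /= mulr1.
Qed.

Lemma Lpnorm_fatou (w_ : (T -> R)^nat) w c :
  (forall n, w_ n \in Lp) -> measurable_fun setT w ->
  {ae mu, forall x, w_ n x @[n --> \oo] --> w x} ->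
  (forall n, N (w_ n) <= c) -> w \in Lp /\ N w <= c.
Proof.
move=> wL wm [B [mB B0 cB]] Nc.
have c0 : 0 <= c by exact: le_trans (Lpnorm_ge0 _ _ _) (Nc 0%N).
have mpow v : measurable_fun setT v ->
    measurable_fun setT (EFin \o (fun x => `|v x| `^ p)).
  move=> vm; apply/measurable_EFinP.
  apply/(@measurableT_comp _ _ _ _ _ _ (@powR R ^~ p)) => //.
  exact: measurableT_comp.
have pow0 v x : (0 <= (`|v x| `^ p)%:E)%E.
  by rewrite lee_fin powR_ge0.
have J : (\int[mu]_x (`|w x| `^ p)%:E <= (c `^ p)%:E)%E.
  rewrite (ge0_negligible_integral mB measurableT (mpow _ wm)
    (fun x _ => pow0 w x) B0) setTD /=.
  have -> : (\int[mu]_(x in ~` B) (`|w x| `^ p)%:E =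
      \int[mu]_(x in ~` B) limn_einf (fun n => (`|w_ n x| `^ p)%:E))%E.
    apply: eq_integral => x; rewrite inE => Bx.
    have wx : w_ n x @[n --> \oo] --> w x.
      by apply: contrapT => ncvg; exact/Bx/cB.
    have wp : (`|w_ n x| `^ p)%:E @[n --> \oo] --> (`|w x| `^ p)%:E.
      apply/fine_cvgP; split; first exact: nearW.
      by apply: cvg_powR => //; exact: cvg_norm.
    by have [->] := cvg_limn_einf_sup wp.
  apply: le_trans (fatou _ (measurableC mB) _ _) _.
  - by move=> n; apply: measurable_funS (mpow _ (Lp_measurable (wL n))).
  - by move=> n x _; exact: pow0.
  rewrite limn_einf_lim; apply: lime_le; first exact: is_cvg_einfs.
  apply: nearW => n.
  apply: (@le_trans _ _ (\int[mu]_(x in ~` B) (`|w_ n x| `^ p)%:E)%E).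
    by apply: ereal_inf_lbound; exists n => /=.
  rewrite -setTD -(ge0_negligible_integral mB measurableT
    (mpow _ (Lp_measurable (wL n))) (fun x _ => pow0 (w_ n) x) B0) /=.
  have := powR_Lpnorm p_gt1 (wL n); rewrite /Rintegral => Jn.
  rewrite -(@fineK _ (\int[mu]_x (`|w_ n x| `^ p)%:E)); last first.
    exact/integrable_fin_num/integrable_powR_norm.
  by rewrite -Jn lee_fin; apply: powR_homo; rewrite ?Lpnorm_ge0 ?(ltW p_gt0).
have wLp : w \in Lp.
  apply/LpP; split => //; apply: (@lty_poweRy _ _ p); first by rewrite gt_eqF.
  by rewrite powR_Lnorm ?gt_eqF//; apply: le_lt_trans J _; rewrite ltry.
split=> //; apply: (@powR_le_inv _ p) => //; first exact: Lpnorm_ge0.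
rewrite powR_Lpnorm// -lee_fin fineK//.
exact/integrable_fin_num/integrable_powR_norm.
Qed.

(** Riesz-Fischer: a subsequence with summable increments converges almost
    everywhere, and Fatou's lemma bounds the distance to its limit. *)
Lemma Lp_complete (u_ : (T -> R)^nat) :
  (forall n, u_ n \in Lp) ->
  (forall e, 0 < e -> exists n, forall i j, (n <= i)%N -> (n <= j)%N ->
     N (u_ i \- u_ j) <= e) ->
  exists2 u, u \in Lp & N (u_ n \- u) @[n --> \oo] --> 0.
Proof.
move=> uL ucauchy.
have /choice[f fP] : forall k, exists n, forall i j, (n <= i)%N -> (n <= j)%N ->
    N (u_ i \- u_ j) <= 2^-1 ^+ k.
  by move=> k; apply: ucauchy; exact: half_expn_gt0.
pose g k := (\max_(i < k.+1) f i)%N.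
have fg j k : (j <= k)%N -> (f j <= g k)%N.
  by rewrite -ltnS => jk; exact: (leq_bigmax (Ordinal jk)).
pose v k := u_ (g k.+1) \- u_ (g k).
have vL k : v k \in Lp by exact: LpB.
have [C C0 CL1] := integral_norm_le_Lpnorm.
have vcvg : {ae mu, forall x, cvgn (series (v ^~ x))}.
  apply: (@ae_cvg_series _ _ _ _ _ C) => //.
    by move=> k; exact: Lp_measurable (vL k).
  move=> k; apply: le_trans (CL1 _ (vL k)) _.
  by rewrite lee_fin ler_wpM2l//; apply: fP; exact: fg.
have [u um ucvg] : exists2 u : T -> R, measurable_fun setT u &
    {ae mu, forall x, u_ (g n) x @[n --> \oo] --> u x}.
  apply: ae_cvg_measurable; first by move=> n; exact/Lp_measurable.
  apply: filterS vcvg => x vx.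
  have -> : (fun n => u_ (g n) x) = (fun n => u_ (g 0%N) x + series (v ^~ x) n).
    apply/funext => n.
    by rewrite (_ : v ^~ x = telescope (fun n => u_ (g n) x))// -eq_sum_telescope.
  by apply: is_cvgD => //; exact: is_cvg_cst.
have key e : 0 < e -> exists n, forall i, (n <= i)%N ->
    u_ i \- u \in Lp /\ N (u_ i \- u) <= e.
  move=> e0; have [k ke] := half_expn_le e0; exists (f k) => i ki.
  apply: (@Lpnorm_fatou (fun j => u_ i \- u_ (g (j + k)%N))).
  - by move=> j; exact: LpB.
  - by apply: measurable_funB => //; exact: Lp_measurable.
  - apply: filterS ucvg => x ux; apply: cvgB; first exact: cvg_cst.
    by have := ux; rewrite -(cvg_shiftn k).
  - move=> j; apply: le_trans (ke k (leqnn k)).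
    by apply: fP => //; exact/fg/leq_addl.
exists u.
  have [n /(_ _ (leqnn n))[nuL _]] := key 1 ltr01.
  rewrite (_ : u = u_ n \- (u_ n \- u)); first exact: LpB.
  by apply/funext => x /=; rewrite opprB addrC subrK.
apply/cvgr0Pnorm_le => e e0; have [n nP] := key e e0.
by exists n => // i /nP[_]; rewrite ger0_norm// Lpnorm_ge0.
Qed.

End Lp_complete.

(** * A distance for convergence in measure *)

Section L0dist.
Context d (T : measurableType d) (R : realType).
Variable mu : {finite_measure set T -> \bar R}.
Implicit Types u v w : T -> R.

(** The truncation makes this distance finite on all measurable functions; on a
    finite measure space it metrizes convergence in measure. *)
Definition L0dist u v : R := \int[mu]_x Num.min `|u x - v x| 1.

Lemma L0dist_measurable u v : measurable_fun setT u -> measurable_fun setT v ->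
  measurable_fun [set: T] (fun x => Num.min `|u x - v x| (1:R)).
Proof.
move=> um vm; apply: measurable_minr => //.
by apply: measurableT_comp => //; exact: measurable_funB.
Qed.

Lemma min1_ge0 (r : R) : 0 <= r -> 0 <= Num.min r 1.
Proof. by move=> r0; rewrite le_min r0 ler01. Qed.

Lemma L0dist_integrable u v : measurable_fun setT u -> measurable_fun setT v ->
  mu.-integrable setT (EFin \o (fun x => Num.min `|u x - v x| (1:R))).
Proof.
move=> um vm.
apply: le_integrable (finite_measure_integrable_cst mu 1 measurableT) => //.
  exact/measurable_EFinP/L0dist_measurable.
by move=> x _ /=; rewrite normr1 lee_fin ger0_norm ?min1_ge0.
Qed.

Lemma L0dist_ge0 u v : 0 <= L0dist u v.
Proof. by apply: Rintegral_ge0 => x _; exact: min1_ge0. Qed.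

Lemma L0dist_le_add u v u1 v1 u2 v2 :
  measurable_fun setT u -> measurable_fun setT v ->
  measurable_fun setT u1 -> measurable_fun setT v1 ->
  measurable_fun setT u2 -> measurable_fun setT v2 ->
  (forall x, `|u x - v x| <= `|u1 x - v1 x| + `|u2 x - v2 x|) ->
  L0dist u v <= L0dist u1 v1 + L0dist u2 v2.
Proof.
move=> um vm u1m v1m u2m v2m uv; rewrite /L0dist -RintegralD//;
  try exact: L0dist_integrable.
apply: le_Rintegral => //; first exact: L0dist_integrable.
  exact: (integrableD measurableT (L0dist_integrable u1m v1m)
    (L0dist_integrable u2m v2m)).
move=> x _; have := uv x.
move: `|u x - v x| `|u1 x - v1 x| `|u2 x - v2 x| (normr_ge0 (u1 x - v1 x))
  (normr_ge0 (u2 x - v2 x)) => a b c b0 c0 abc.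
by rewrite /Num.min; do 3 case: ltP => ?; lra.
Qed.

Lemma L0dist_triangle v u w : measurable_fun setT u -> measurable_fun setT v ->
  measurable_fun setT w -> L0dist u w <= L0dist u v + L0dist v w.
Proof.
move=> um vm wm; apply: L0dist_le_add => // x; exact: ler_distD.
Qed.

(** Truncated distances are not convex, which is why the bound is the sum
    rather than the mean. *)
Lemma L0dist_midpoint u v w : measurable_fun setT u -> measurable_fun setT v ->
  measurable_fun setT w ->
  L0dist (fun x => 2^-1 * (u \+ v) x) w <= L0dist u w + L0dist v w.
Proof.
move=> um vm wm; apply: L0dist_le_add => //.
  by apply: measurable_funM => //; exact: measurable_funD.
move=> x /=; rewrite (_ : _ - w x = 2^-1 * ((u x - w x) + (v x - w x))).
  rewrite normrM ger0_norm ?invr_ge0//.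
  apply: (@le_trans _ _ `|(u x - w x) + (v x - w x)|); last exact: ler_normD.
  by rewrite ler_piMl// invf_le1 ?ler1n.
by field.
Qed.

Lemma ae_cvg_L0dist (u_ : (T -> R)^nat) u :
  (forall n, measurable_fun setT (u_ n)) -> measurable_fun setT u ->
  {ae mu, forall x, u_ n x @[n --> \oo] --> u x} ->
  L0dist (u_ n) u @[n --> \oo] --> 0.
Proof.
move=> um_ um ucvg.
have [_ _ J] : [/\ mu.-integrable setT (cst 0%E),
    [sequence \int[mu]_x `|(Num.min `|u_ n x - u x| 1)%:E - 0|]_n @ \oo --> 0%E &
    [sequence \int[mu]_x (Num.min `|u_ n x - u x| 1)%:E]_n @ \oo
       --> \int[mu]_x (cst 0 x)]%E.
  apply: (@dominated_convergence _ _ _ mu setT measurableT _ _ (EFin \o cst 1)).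
  - by move=> n; apply/measurable_EFinP/L0dist_measurable.
  - exact: measurable_cst.
  - apply: filterS ucvg => x ux _.
    apply/fine_cvgP; split; first exact: nearW.
    apply/cvgr0Pnorm_lt => e e0.
    have /cvgrPdist_lt/(_ _ e0) := ux; apply: filterS => n /= un.
    by rewrite ger0_norm ?min1_ge0// gt_min distrC un.
  - exact: finite_measure_integrable_cst.
  - apply: aeW => x n _.
    rewrite gee0_abs ?lee_fin ?min1_ge0//.
    by rewrite ge_min lexx orbT.
by move: J; rewrite integral0 => /fine_cvgP[_].
Qed.

(** The truncated differences are the terms of a series that converges almost
    everywhere, hence they tend to 0. *)
Lemma L0dist_cvg_ae (u_ : (T -> R)^nat) u :
  (forall n, measurable_fun setT (u_ n)) -> measurable_fun setT u ->
  (forall n, L0dist (u_ n) u <= 2^-1 ^+ n) ->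
  {ae mu, forall x, u_ n x @[n --> \oo] --> u x}.
Proof.
move=> um_ um ud.
have : {ae mu, forall x, cvgn (series (fun n => Num.min `|u_ n x - u x| (1:R)))}.
  apply: (@ae_cvg_series _ _ _ _ (fun n x => Num.min `|u_ n x - u x| 1) 1) => //.
    by move=> n; exact: L0dist_measurable.
  move=> n; rewrite mul1r.
  under eq_integral do rewrite ger0_norm ?min1_ge0//.
  rewrite -[leLHS]fineK; first by rewrite lee_fin; exact: ud.
  exact/integrable_fin_num/L0dist_integrable.
apply: filterS => x /cvg_series_cvg_0 /cvgr0Pnorm_lt cv.
apply/cvgrPdist_lt => e e0.
have := cv (Num.min e 1); rewrite lt_min e0 ltr01 => /(_ isT).
apply: filterS => n; rewrite ger0_norm ?min1_ge0// lt_min !gt_min ltxx orbF.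
by rewrite (distrC (u x)) => /andP[/orP[//|e1] /lt_trans]; exact.
Qed.

Lemma cvg_in_measure_L0dist (u_ : (T -> R)^nat) u :
  (forall n, measurable_fun setT (u_ n)) -> measurable_fun setT u ->
  cvg_in_measure mu u_ u -> L0dist (u_ n) u @[n --> \oo] --> 0.
Proof.
move=> um_ um ucvg; apply/cvgr0Pnorm_lt => e e0.
pose M := fine (mu setT); have M0 : 0 <= M by rewrite fine_ge0.
pose e' := e / (2 * (M + 1)).
have e'0 : 0 < e' by rewrite divr_gt0// mulr_gt0// ltr_wpDl.
have e'M : e' * M < e / 2.
  rewrite /e' invfM mulrA -mulrA gtr_pMr ?divr_gt0//.
  by rewrite mulrC ltr_pdivrMr ?mul1r ?ltrDl// ltr_wpDl.
have := ucvg e' e'0 => /fine_cvgP[_] /cvgr0Pnorm_lt/(_ (e / 2)).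
rewrite divr_gt0// => /(_ isT); apply: filterS => n /=.
set A := [set x | _] => /(le_lt_trans (ler_norm _)) muA.
rewrite ger0_norm ?L0dist_ge0//.
have mA : measurable A.
  rewrite -[A]setTI; apply: measurable_fun_le => //.
  by apply: measurableT_comp => //; exact: measurable_funB.
have iA : mu.-integrable setT (EFin \o (\1_A : T -> R)).
  exact: integrable_indic.
have ic := finite_measure_integrable_cst mu e' measurableT.
apply: (@le_lt_trans _ _ (\int[mu]_x (e' + \1_A x))).
  apply: le_Rintegral => //; first exact: L0dist_integrable.
    exact: (integrableD measurableT ic iA).
  move=> x _; rewrite indicE; have [xA|xA] := boolP (x \in A).
    by rewrite ge_min lerDr (ltW e'0) orbT.
  rewrite addr0 ge_min; apply/orP; left; rewrite leNgt; apply/negP => ex.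
  by move/negP: xA; apply; rewrite inE /A /= ltW.
rewrite RintegralD// Rintegral_cst// -/M [X in _ + X](_ : _ = fine (mu A)).
  lra.
by rewrite /Rintegral integral_indic// setIT.
Qed.

Lemma L0dist_cvg_in_measure (u_ : (T -> R)^nat) u :
  (forall n, measurable_fun setT (u_ n)) -> measurable_fun setT u ->
  L0dist (u_ n) u @[n --> \oo] --> 0 -> cvg_in_measure mu u_ u.
Proof.
move=> um_ um u0 e e0; pose e' := Num.min e 1.
have e'0 : 0 < e' by rewrite lt_min e0 ltr01.
have mA n (r : R) : measurable [set x | r <= `|u_ n x - u x|].
  rewrite -[X in measurable X]setTI; apply: measurable_fun_le => //.
  by apply: measurableT_comp => //; exact: measurable_funB.
have fin n : mu [set x | e <= `|u_ n x - u x|] \is a fin_num.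
  exact: fin_num_measure.
apply/fine_cvgP; split; first exact: nearW.
apply/cvgr0Pnorm_lt => eps eps0.
move/cvgr0Pnorm_lt : u0 => /(_ (e' * eps)); rewrite mulr_gt0// => /(_ isT).
apply: filterS => n /(le_lt_trans (ler_norm _)) un /=.
rewrite ger0_norm ?fine_ge0// -(ltr_pM2l e'0); apply: le_lt_trans un.
rewrite -lee_fin EFinM fineK// [leRHS]fineK; last first.
  exact/integrable_fin_num/L0dist_integrable.
have := @le_integral_abse _ _ _ mu setT measurableT
  (fun x => (Num.min `|u_ n x - u x| 1)%:E) e'.
have mm : measurable_fun [set: T] (EFin \o (fun x => Num.min `|u_ n x - u x| (1:R))).
  exact/measurable_EFinP/L0dist_measurable.
move=> /(_ mm e'0); rewrite setTI => h; apply: le_trans (le_trans h _).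
  rewrite lee_pmul2l// le_measure ?inE//.
    rewrite -[X in measurable X]setTI.
    by apply: emeasurable_fun_c_infty => //; exact: measurableT_comp.
  move=> x /= ex; rewrite lee_fin ger0_norm ?min1_ge0//.
  by rewrite le_min !ge_min ex lexx orbT.
under eq_integral do rewrite gee0_abs ?lee_fin ?min1_ge0//.
exact: lexx.
Qed.

End L0dist.

(** * Separation of convex sets and Mazur's lemma *)

Section sublinear.
Context {R : realType} {V : lmodType R}.
Implicit Types (q r : V -> R) (x y : V).

Definition sublinear q := (forall x y, q (x + y) <= q x + q y) /\
  (forall (t : R) x, 0 < t -> q (t *: x) <= t * q x).

Lemma sublinearZ q t x : sublinear q -> 0 < t -> q (t *: x) = t * q x.
Proof.
move=> [_ qZ] t0; apply/eqP; rewrite eq_le qZ//=.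
rewrite -ler_pdivlMl//; apply: le_trans (qZ _ _ _); rewrite ?invr_gt0//.
by rewrite scalerA mulVf ?gt_eqF// scale1r.
Qed.

Lemma sublinear0 q : sublinear q -> q 0 = 0.
Proof.
move=> sq; have := sublinearZ 0 sq (ltr0n R 2); rewrite scaler0 => h.
by lra.
Qed.

Lemma sublinearN q x : sublinear q -> - q (- x) <= q x.
Proof.
move=> sq; have := sq.1 x (- x); rewrite subrr sublinear0//; lra.
Qed.

Let inf_family (I : Type) (P : set I) (q : I -> V -> R) x :=
  inf [set q i x | i in P].

(** The index [k] may depend on the points: this covers infima of chains as well
    as infima of families indexed by a cone. *)
Let sublinear_inf_family (I : Type) (P : set I) (q : I -> V -> R)
    (b : V -> R) :
  P !=set0 -> (forall i x, P i -> b x <= q i x) ->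
  (forall i j x y, P i -> P j -> exists2 k, P k & q k (x + y) <= q i x + q j y) ->
  (forall i (t : R) x, P i -> 0 < t -> exists2 k, P k & q k (t *: x) <= t * q i x) ->
  sublinear (inf_family P q).
Proof.
move=> [i0 Pi0] bq qD qZ.
have lb x : has_lbound [set q i x | i in P].
  by exists (b x) => _ [i Pi <-]; exact: bq.
have ne x : [set q i x | i in P] !=set0 by exists (q i0 x), i0.
have qinf i x : P i -> inf_family P q x <= q i x.
  by move=> Pi; apply: ge_inf => //; exists i.
split=> [x y|t x t0].
  rewrite -lerBlDr; apply: lb_le_inf => // _ [i Pi <-].
  rewrite lerBlDr -lerBlDl; apply: lb_le_inf => // _ [j Pj <-].
  rewrite lerBlDl; have [k Pk kij] := qD i j x y Pi Pj.
  exact: le_trans (qinf k _ Pk) kij.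
rewrite -ler_pdivrMl//; apply: lb_le_inf => // _ [i Pi <-].
rewrite ler_pdivrMl//; have [k Pk ki] := qZ i t x Pi t0.
exact: le_trans (qinf k _ Pk) ki.
Qed.

(** Zorn's lemma gives a minimal sublinear [r] below [q].  For each [y], the
    functional that maps [x] to the infimum of [r (x + t *: y) - t * r y] over
    [t >= 0] is sublinear and at most [r], so it equals [r]; the index [t = 1]
    then shows that [r] is superadditive, hence linear. *)
Lemma sublinear_linear_minorant q : sublinear q -> exists phi : V -> R,
  (forall (c : R) x y, phi (c *: x + y) = c * phi x + phi y) /\
  (forall x, phi x <= q x).
Proof.
move=> sq.
pose S := {r : V -> R | sublinear r /\ forall x, r x <= q x}.
pose below (r s : S) := `[< forall x, sval s x <= sval r x >].
have q0 : S by exists q; split.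
have [||A Atot|[r [sr rq]] rmin] := @ZL_preorder S q0 below.
- by move=> r; apply/asboolP => x.
- move=> r s t /asboolP rs /asboolP st; apply/asboolP => x.
  exact: le_trans (rs x).
- have [[r0 Ar0]|A0] := pselect (A !=set0); last first.
    by exists q0 => s As; exfalso; apply: A0; exists s.
  have lb (i : S) x : A i -> - q (- x) <= sval i x.
    move=> _; case: i => r [sr rq] /=; apply: le_trans (sublinearN _ sr).
    by rewrite lerN2.
  have D (i j : S) x y : A i -> A j ->
      exists2 k, A k & sval k (x + y) <= sval i x + sval j y.
    move=> Ai Aj; have [/asboolP ij|/asboolP ji] := Atot _ _ Ai Aj.
      by exists j => //; apply: le_trans ((svalP j).1.1 _ _) _; rewrite lerD2r.
    by exists i => //; apply: le_trans ((svalP i).1.1 _ _) _; rewrite lerD2l.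
  have Z (i : S) (t : R) x : A i -> 0 < t ->
      exists2 k, A k & sval k (t *: x) <= t * sval i x.
    by move=> Ai t0; exists i => //; exact: (svalP i).1.2.
  have Fi (i : S) x : A i -> inf_family A (fun i => sval i) x <= sval i x.
    move=> Ai; apply: ge_inf; last by exists i.
    by exists (- q (- x)) => _ [j Aj <-]; exact: lb.
  have sF := sublinear_inf_family (ex_intro _ r0 Ar0) lb D Z.
  have Fq x : inf_family A (fun i => sval i) x <= q x.
    exact: le_trans (Fi _ _ Ar0) ((svalP r0).2 x).
  exists (exist (fun r => sublinear r /\ forall x, r x <= q x) _ (conj sF Fq)).
  by move=> s As; apply/asboolP => x; exact: Fi.
have radd x y : r (x + y) = r x + r y.
  pose P : set R := [set t | 0 <= t].
  pose ry (t : R) x := r (x + t *: y) - t * r y.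
  have rty t : 0 <= t -> r (t *: y) = t * r y.
    rewrite le_eqVlt => /predU1P[<-|t0]; last exact: sublinearZ.
    by rewrite scale0r mul0r sublinear0.
  have lb t z : P t -> - r (- z) <= ry t z.
    move=> t0; have := sr.1 (z + t *: y) (- z).
    by rewrite /ry addrAC subrr add0r rty//; lra.
  have D (s t : R) z z' : P s -> P t ->
      exists2 k, P k & ry k (z + z') <= ry s z + ry t z'.
    move=> s0 t0; exists (s + t); first exact: addr_ge0.
    have := sr.1 (z + s *: y) (z' + t *: y).
    by rewrite addrACA -scalerDl /ry mulrDl; lra.
  have Z (s t : R) z : P s -> 0 < t -> exists2 k, P k & ry k (t *: z) <= t * ry s z.
    move=> s0 t0; exists (t * s); first by rewrite /P/= mulr_ge0// ltW.
    by rewrite /ry -scalerA -scalerDr mulrBr mulrA lerD2r; exact: sr.2.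
  have P1 : P 1 by rewrite /P /=.
  have sF := sublinear_inf_family (ex_intro _ 1 P1) lb D Z.
  have Fi (t : R) z : P t -> inf_family P ry z <= ry t z.
    move=> Pt; apply: ge_inf; last by exists t.
    by exists (- r (- z)) => _ [s Ps <-]; exact: lb.
  have Fr z : inf_family P ry z <= r z.
    have P0 : P 0 by rewrite /P /=.
    by have := Fi 0 z P0; rewrite /ry scale0r addr0 mul0r subr0.
  have Fq z : inf_family P ry z <= q z by exact: le_trans (Fr z) (rq z).
  have /asboolP/(_ x)/= rF := rmin
    (exist (fun r => sublinear r /\ forall x, r x <= q x) _ (conj sF Fq))
    (asboolT Fr).
  apply/eqP; rewrite eq_le sr.1/=.
  have := le_trans rF (Fi 1 x P1); rewrite /ry scale1r mul1r; lra.
have rN x : r (- x) = - r x.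
  by apply/eqP; rewrite -addr_eq0 -radd addNr sublinear0.
exists r; split=> // c x y; rewrite radd; congr (_ + _).
have [c0|c0|->] := ltgtP c 0.
- have Nc0 : 0 < - c by rewrite oppr_gt0.
  by have := sublinearZ x sr Nc0; rewrite scaleNr rN mulNr => /oppr_inj.
- exact: sublinearZ.
- by rewrite scale0r mul0r sublinear0.
Qed.

(** The infimum of [N (x + s *: w) - s * dl] over [s >= 0] and [w] in [D] is
    sublinear; it is finite because [N (s *: w) >= s * dl].  A linear minorant
    is bounded by [N] (take [s = 0]) and is at most [- dl] at [- w] (take
    [s = 1]). *)
Lemma convex_separation (N : V -> R) (D : set V) (dl : R) :
  (forall x y, N (x + y) <= N x + N y) ->
  (forall (c : R) x, N (c *: x) = `|c| * N x) ->
  (forall x y (s t : R), D x -> D y -> 0 <= s -> 0 <= t -> s + t = 1 ->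
     D (s *: x + t *: y)) ->
  (forall x, D x -> dl <= N x) ->
  exists phi : V -> R,
  [/\ forall (c : R) x y, phi (c *: x + y) = c * phi x + phi y,
      forall x, `|phi x| <= N x & forall x, D x -> dl <= phi x].
Proof.
move=> ND NZ Dconv Ddl.
have N0 : N 0 = 0 by rewrite -(scale0r 0) NZ normr0 mul0r.
have NN x : N (- x) = N x by rewrite -scaleN1r NZ normrN1 mul1r.
have Nge0 x : 0 <= N x.
  by have := ND x (- x); rewrite subrr N0 NN; lra.
pose P : set (R * V) := [set sv | sv = (0, 0) \/
  exists2 s, 0 < s & exists2 w, D w & sv = (s, s *: w)].
pose g (sv : R * V) x := N (x + sv.2) - sv.1 * dl.
have P0 : P (0, 0) by left.
have lb sv x : P sv -> - N x <= g sv x.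
  rewrite /g => -[->/=|[s s0 [w Dw ->/=]]].
    by rewrite addr0 mul0r subr0; have := Nge0 x; lra.
  have := ND (- x) (x + s *: w); rewrite addKr NN NZ gtr0_norm//.
  have : s * dl <= s * N w by rewrite ler_pM2l//; exact: Ddl.
  lra.
have PD sv sv' : P sv -> P sv' -> P (sv.1 + sv'.1, sv.2 + sv'.2).
  move=> [->/=|[s s0 [w Dw ->/=]]] [->/=|[t t0 [w' Dw' ->/=]]]; rewrite ?add0r.
  - by left.
  - by right; exists t => //; exists w'.
  - by rewrite !addr0; right; exists s => //; exists w.
  - right; exists (s + t); first exact: addr_gt0.
    have st0 : s + t != 0 by rewrite gt_eqF// addr_gt0.
    exists ((s / (s + t)) *: w + (t / (s + t)) *: w').
      apply: Dconv => //; rewrite ?divr_ge0 ?addr_ge0 ?(ltW s0) ?(ltW t0)//.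
      by rewrite -mulrDl mulfV.
    by rewrite scalerDr !scalerA !(mulrC (s + t)) !mulfVK.
have gD sv sv' x y : P sv -> P sv' ->
    exists2 k, P k & g k (x + y) <= g sv x + g sv' y.
  move=> Psv Psv'; exists (sv.1 + sv'.1, sv.2 + sv'.2); first exact: PD.
  have := ND (x + sv.2) (y + sv'.2).
  by rewrite /g /= addrACA mulrDl; lra.
have gZ sv (t : R) x : P sv -> 0 < t ->
    exists2 k, P k & g k (t *: x) <= t * g sv x.
  move=> Psv t0; exists (t * sv.1, t *: sv.2).
    case: Psv => [->/=|[s s0 [w Dw ->/=]]].
      by left; rewrite mulr0 scaler0.
    by right; exists (t * s); [exact: mulr_gt0|exists w; rewrite ?scalerA].
  by rewrite /g /= -scalerDr NZ gtr0_norm// mulrBr mulrA.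
have sF := sublinear_inf_family (ex_intro _ _ P0) lb gD gZ.
have Fi sv x : P sv -> inf_family P g x <= g sv x.
  move=> Psv; apply: ge_inf; last by exists sv.
  by exists (- N x) => _ [s Ps <-]; exact: lb.
have [phi [lin phiF]] := sublinear_linear_minorant sF.
have phi0 : phi 0 = 0.
  by have := lin 1 0 0; rewrite scaler0 addr0 mul1r; lra.
have phiN x : phi (- x) = - phi x.
  by have := lin (-1) x 0; rewrite scaleN1r !addr0 phi0 mulN1r addr0.
have phile x : phi x <= N x.
  apply: le_trans (phiF x) (le_trans (Fi _ x P0) _).
  by rewrite /g/= addr0 mul0r subr0.
exists phi; split=> // x; last first.
  move=> Dx; have P1 : P (1, 1 *: x) by right; exists 1 => //; exists x.
  have := le_trans (phiF (- x)) (Fi _ (- x) P1).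
  by rewrite /g/= scale1r addNr N0 mul1r phiN; lra.
by rewrite ler_norml phile andbT -[X in - X]NN lerNl -phiN.
Qed.

End sublinear.

Section mazur.
Context d (T : measurableType d) (R : realType).
Variable mu : {finite_measure set T -> \bar R}.
Variables (p : R) (p_gt1 : 1 < p).
Implicit Types u v : T -> R.
Local Notation Lp := (Lfun mu p%:E).
Local Notation N := (Lpnorm mu p).

Let p_ge1 : (1 <= p%:E)%E. Proof. by rewrite lee_fin ltW. Qed.

(** If [C] stayed at distance [e] from [g], a continuous functional would
    exceed [e] on every [u_ n - g], against weak convergence. *)
Lemma mazur (C : set (T -> R)) (u_ : (T -> R)^nat) g e :
  (forall u, C u -> u \in Lp) ->
  (forall u v (s t : R), C u -> C v -> 0 <= s -> 0 <= t -> s + t = 1 ->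
     C (fun x => s * u x + t * v x)) ->
  (forall n, C (u_ n)) -> weak_cvg_Lp mu p%:E u_ g -> 0 < e ->
  exists2 u, C u & N (u \- g) <= e.
Proof.
move=> CL Cconv Cu [uL gL uweak] e0; apply: contrapT => nC.
pose V := LfunType mu p_ge1.
pose D : set V := [set w | exists2 u, C u & (w : T -> R) = u \- g].
pose nrm (w : V) : R := N w.
have ND w w' : nrm (w + w') <= nrm w + nrm w'.
  by apply: (LpnormD p_gt1); exact: LfunP.
have NZ (c : R) w : nrm (c *: w) = `|c| * nrm w.
  by apply: (LpnormZ p_gt1); exact: LfunP.
have Dconv w w' (s t : R) : D w -> D w' -> 0 <= s -> 0 <= t -> s + t = 1 ->
    D (s *: w + t *: w').
  move=> [u Cu_ wu] [u' Cu' wu'] s0 t0 st.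
  exists (fun x => s * u x + t * u' x); first exact: Cconv.
  apply/funext => x.
  rewrite -[LHS]/(s * (w : T -> R) x + t * (w' : T -> R) x) wu wu' /=.
  by rewrite !mulrBr -[g x in RHS]mul1r -st; ring.
have De w : D w -> e <= nrm w.
  move=> [u Cu_ wu]; rewrite leNgt; apply/negP => we; apply: nC; exists u => //.
  by rewrite ltW// -wu.
have [phi [lin bnd sep]] := convex_separation ND NZ Dconv De.
pose psi (u : T -> R) : R :=
  if pselect (u \in Lp) is left uLp then phi (Lfun_Sub p_ge1 uLp) else 0.
have psiE u (uLp : u \in Lp) : psi u = phi (Lfun_Sub p_ge1 uLp).
  rewrite /psi; case: pselect => // uLp'.
  by rewrite (bool_irrelevance uLp uLp').
have psi_dual : Lp_dual mu p%:E psi.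
  split=> [c u v uLp vLp|].
    have cuvLp : ((c \*: u) \+ v) \in Lp by apply: LpD => //; exact: LpZ.
    by rewrite !psiE -lin; congr phi; exact: val_inj.
  exists 1 => u uLp; rewrite mul1e psiE -(LpnormE p_gt1 uLp) lee_fin.
  exact: bnd.
have /cvgrPdist_lt/(_ e e0)[n _ /(_ n (leqnn n))/=] := uweak psi psi_dual.
apply/negP; rewrite -leNgt distrC.
apply: le_trans (ler_norm _); rewrite (psiE _ (uL n)) (psiE _ gL).
have Dn : D (Lfun_Sub p_ge1 (uL n) - Lfun_Sub p_ge1 gL) by exists (u_ n).
have := sep _ Dn; rewrite addrC -scaleN1r lin.
by rewrite mulN1r addrC.
Qed.

End mazur.

(** * The asymptotic Lipschitz constant *)

Section lip_calculus.
Context {R : realType} {X : metricType R}.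
Implicit Types (f g h : X -> R) (x y z : X) (A B : set X) (c e r : R).

Lemma Lip_b_lipschitz f : Lip_b f ->
  exists2 L, 0 <= L & forall x y, `|f x - f y| <= L * mdist x y.
Proof.
move=> [_ [L fL]]; exists (Num.max L 0); first by rewrite le_max lexx orbT.
by move=> x y; apply: le_trans (fL x y) _; rewrite ler_wpM2r ?mdist_ge0// le_max lexx.
Qed.

Lemma Lip_ge0 f A x : A x -> (0 <= Lip f A)%E.
Proof.
move=> Ax; apply: le_ereal_sup_tmp; exists 0%E => //.
by exists (x, x) => //=; rewrite subrr normr0 mul0r.
Qed.

Lemma Lip_leP f A c : 0 <= c ->
  (Lip f A <= c%:E)%E <->
  (forall y z, A y -> A z -> `|f y - f z| <= c * mdist y z).
Proof.
move=> c0; split=> [fA y z Ay Az|fA].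
  have [->|yz] := eqVneq y z; first by rewrite subrr normr0 mulr_ge0 ?mdist_ge0.
  rewrite -ler_pdivrMr ?mdist_gt0// -lee_fin; apply: le_trans fA.
  by apply: ereal_sup_ubound; exists (y, z).
apply: ge_ereal_sup => _ [[y z] [/= Ay Az] <-]; rewrite lee_fin.
have [->|yz] := eqVneq y z; first by rewrite subrr normr0 mul0r.
by rewrite ler_pdivrMr ?mdist_gt0//; exact: fA.
Qed.

Lemma le_Lip f A B : A `<=` B -> (Lip f A <= Lip f B)%E.
Proof.
by move=> AB; apply: ereal_sup_le => _ [yz [Ay Az] <-]; exists yz => //; split; exact: AB.
Qed.

(** The Lipschitz constant of a ball increases with its radius, so its limit is
    an infimum; it is finite for a Lipschitz function. *)
Lemma lip_inf f x : Lip_b f ->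
  (lip f x)%:E = ereal_inf [set Lip f (ball x r) | r in [set r | 0 < r]].
Proof.
move=> fb; have [L L0 fL] := Lip_b_lipschitz fb.
have -> : [set r : R | 0 < r] = [set` Interval (BRight 0) +oo%O].
  by apply/seteqP; split => r; rewrite /= in_itv/= andbT.
have cvg_inf : Lip f (ball x r) @[r --> 0^'+] -->
    ereal_inf ((fun r => Lip f (ball x r)) @` [set` Interval (BRight (0:R)) +oo%O]).
  apply: nondecreasing_at_right_cvge => // r s _ _ rs.
  exact/le_Lip/le_ball.
rewrite /lip (cvg_lim _ cvg_inf)// fineK//.
rewrite ge0_fin_numE.
  apply: (@le_lt_trans _ _ L%:E); last exact: ltry.
  apply: (@le_trans _ _ (Lip f (ball x 1))).
    by apply: ereal_inf_lbound; exists 1 => //; rewrite /= in_itv/= ltr01.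
  by apply/Lip_leP => // y z _ _; exact: fL.
apply: le_ereal_inf_tmp => _ [r /= + <-]; rewrite in_itv/= andbT => r0.
exact/Lip_ge0/ballxx.
Qed.

Lemma lip_ge0 f x : Lip_b f -> 0 <= lip f x.
Proof.
move=> fb; rewrite -lee_fin lip_inf//.
by apply: le_ereal_inf_tmp => _ [r /= r0 <-]; exact/Lip_ge0/ballxx.
Qed.

Lemma lip_le f x r c : Lip_b f -> 0 < r -> 0 <= c ->
  (forall y z, ball x r y -> ball x r z -> `|f y - f z| <= c * mdist y z) ->
  lip f x <= c.
Proof.
move=> fb r0 c0 fc; rewrite -lee_fin lip_inf//.
apply: (@le_trans _ _ (Lip f (ball x r))); last exact/Lip_leP.
by apply: ereal_inf_lbound; exists r.
Qed.

Lemma lip_lt f x c : Lip_b f -> lip f x < c -> exists2 r, 0 < r &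
  forall y z, ball x r y -> ball x r z -> `|f y - f z| <= c * mdist y z.
Proof.
move=> fb fc; have c0 : 0 <= c by rewrite ltW// (le_lt_trans (lip_ge0 x fb)).
move: fc; rewrite -lte_fin lip_inf// => /ereal_inf_lt[_ [r r0 <-] /ltW rc].
by exists r => //; apply/Lip_leP.
Qed.

Lemma lip_le_lipschitz f x L : Lip_b f -> 0 <= L ->
  (forall y z, `|f y - f z| <= L * mdist y z) -> lip f x <= L.
Proof. by move=> fb L0 fL; apply: (@lip_le _ _ 1). Qed.

Lemma lip_cst c x : lip (fun _ : X => c) x = 0.
Proof.
have cb : Lip_b (fun _ : X => c).
  by split; [exists (`|c|)|exists 0 => y z; rewrite subrr normr0 mul0r].
apply/eqP; rewrite eq_le lip_ge0// andbT; apply: lip_le_lipschitz => // y z.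
by rewrite subrr normr0 mul0r.
Qed.

Lemma Lip_bD f g : Lip_b f -> Lip_b g -> Lip_b (f \+ g).
Proof.
move=> [[M fM] [L fL]] [[M' gM] [L' gL]]; split.
  by exists (M + M') => x; apply: le_trans (ler_normD _ _) _; exact: lerD.
exists (L + L') => x y /=; rewrite mulrDl opprD addrACA.
by apply: le_trans (ler_normD _ _) _; exact: lerD.
Qed.

Lemma Lip_bZ c f : Lip_b f -> Lip_b (fun x => c * f x).
Proof.
move=> [[M fM] [L fL]]; split.
  by exists (`|c| * M) => x; rewrite normrM ler_wpM2l.
by exists (`|c| * L) => x y; rewrite -mulrBr normrM -mulrA ler_wpM2l.
Qed.

Lemma lipD f g x : Lip_b f -> Lip_b g -> lip (f \+ g) x <= lip f x + lip g x.
Proof.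
move=> fb gb; apply/ler_addgt0Pr => e e0.
have e2 : 0 < e / 2 by rewrite divr_gt0.
have [|r r0 fr] := @lip_lt f x (lip f x + e / 2) fb; first by rewrite ltrDl.
have [|s s0 gs] := @lip_lt g x (lip g x + e / 2) gb; first by rewrite ltrDl.
have f0 := lip_ge0 x fb; have g0 := lip_ge0 x gb.
apply: (@lip_le _ _ (Num.min r s)); first exact: Lip_bD.
- by rewrite lt_min r0.
- by rewrite !addr_ge0// ltW.
move=> y z yrs zrs.
have [yr zr] : ball x r y /\ ball x r z.
  by split; [apply: le_ball yrs|apply: le_ball zrs]; rewrite ge_min lexx.
have [ys zs] : ball x s y /\ ball x s z.
  by split; [apply: le_ball yrs|apply: le_ball zrs]; rewrite ge_min lexx orbT.
rewrite /= opprD addrACA; apply: le_trans (ler_normD _ _) _.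
apply: le_trans (lerD (fr _ _ yr zr) (gs _ _ ys zs)) _.
by rewrite -mulrDl le_eqVlt; apply/orP; left; apply/eqP; congr (_ * _); field.
Qed.

Lemma lipZ c f x : Lip_b f -> lip (fun y => c * f y) x <= `|c| * lip f x.
Proof.
move=> fb; apply/ler_addgt0Pr => e e0.
have c1 : 0 < `|c| + 1 by rewrite ltr_wpDl.
have e' : 0 < e / (`|c| + 1) by rewrite divr_gt0.
have [|r r0 fr] := @lip_lt f x (lip f x + e / (`|c| + 1)) fb.
  by rewrite ltrDl.
have f0 := lip_ge0 x fb.
apply: (@lip_le _ _ r) => //; first exact: Lip_bZ.
  by rewrite addr_ge0 ?mulr_ge0// ltW.
move=> y z yr zr; rewrite -mulrBr normrM.
apply: (@le_trans _ _ (`|c| * ((lip f x + e / (`|c| + 1)) * mdist y z))).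
  by rewrite ler_wpM2l//; exact: fr.
rewrite mulrA ler_wpM2r ?mdist_ge0// mulrDr lerD2l mulrCA ger_pMr//.
by rewrite ler_pdivrMr// mul1r lerDl.
Qed.

Lemma lip_midpoint f g x : Lip_b f -> Lip_b g ->
  lip (fun y => 2^-1 * (f \+ g) y) x <= 2^-1 * (lip f x + lip g x).
Proof.
move=> fb gb; apply: le_trans (lipZ _ _ (Lip_bD fb gb)) _.
by rewrite ger0_norm ?invr_ge0// ler_wpM2l ?invr_ge0// lipD.
Qed.

End lip_calculus.

Section lip_measurable.
Context {R : realType} {X : completeMetricType R}.
Implicit Types (f g h : X -> R) (x y z : X) (U : set X) (c e r : R).

Lemma borel_open U : open U -> measurable (U : set (borel X)).
Proof. by move=> oU; exact: sub_sigma_algebra. Qed.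

Lemma lsc_measurable f : (forall c, open [set x | c < f x]) ->
  measurable_fun [set: borel X] (f : borel X -> R).
Proof.
move=> of_ mD; apply: (measurability _ (RGenOInfty.measurableE R)) => //.
move=> _ [_ [c ->] <-]; rewrite setTI.
rewrite [X in measurable X](_ : _ = [set x | c < f x]); first exact: borel_open.
by apply/seteqP; split => x /=; rewrite in_itv/= andbT.
Qed.

Lemma metric_openP U :
  (forall x, U x -> exists2 r, 0 < r & ball x r `<=` U) -> open U.
Proof.
move=> oU; rewrite openE => x /oU[r r0 rU].
by apply: filterS rU _; exact: nbhsx_ballx.
Qed.

Lemma lipschitz_measurable f L : (forall x y, `|f x - f y| <= L * mdist x y) ->
  measurable_fun [set: borel X] (f : borel X -> R).
Proof.
move=> fL; apply: lsc_measurable => c; apply: metric_openP => x /= cf.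
have M0 : 0 < `|L| + 1 by rewrite ltr_wpDl.
exists ((f x - c) / (`|L| + 1)); first by rewrite divr_gt0// subr_gt0.
move=> y; rewrite ballEmdist/= ltr_pdivlMr// => xy.
have : `|f x - f y| < f x - c.
  apply: le_lt_trans xy; apply: le_trans (fL x y) _; rewrite mulrC.
  rewrite ler_wpM2l ?mdist_ge0//; apply: le_trans (ler_norm L) _.
  by rewrite lerDl.
by rewrite ltr_norml => /andP[]; lra.
Qed.

Lemma Lip_b_measurable f : Lip_b f ->
  measurable_fun [set: borel X] (f : borel X -> R).
Proof. by move=> /Lip_b_lipschitz[L _]; exact: lipschitz_measurable. Qed.

Definition Lip_ball f r x : R := fine (Lip f (ball x r)).

Section Lip_ball.
Variables (f : X -> R) (fb : Lip_b f).

Lemma Lip_ballE r x : 0 < r -> (Lip_ball f r x)%:E = Lip f (ball x r).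
Proof.
move=> r0; have [L L0 fL] := Lip_b_lipschitz fb; rewrite /Lip_ball fineK//.
rewrite ge0_fin_numE ?(Lip_ge0 _ (ballxx x r0))//.
apply: (@le_lt_trans _ _ L%:E); last exact: ltry.
by apply/Lip_leP.
Qed.

Lemma Lip_ball_ge0 r x : 0 < r -> 0 <= Lip_ball f r x.
Proof. by move=> r0; rewrite -lee_fin Lip_ballE// (Lip_ge0 _ (ballxx x r0)). Qed.

Lemma Lip_ballP r x y z : 0 < r -> ball x r y -> ball x r z ->
  `|f y - f z| <= Lip_ball f r x * mdist y z.
Proof.
move=> r0 yr zr.
by apply: (iffLR (Lip_leP f (ball x r) (Lip_ball_ge0 x r0))); rewrite ?Lip_ballE.
Qed.

Lemma Lip_ball_le r x L : 0 < r -> 0 <= L ->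
  (forall y z, ball x r y -> ball x r z -> `|f y - f z| <= L * mdist y z) ->
  Lip_ball f r x <= L.
Proof. by move=> r0 L0 fL; rewrite -lee_fin Lip_ballE//; exact/Lip_leP. Qed.

Lemma lip_le_Lip_ball r x : 0 < r -> lip f x <= Lip_ball f r x.
Proof.
move=> r0; apply: (@lip_le _ _ _ _ r) => //; first exact: Lip_ball_ge0.
by move=> y z; exact: Lip_ballP.
Qed.

Lemma Lip_ball_cvg (r_ : R^nat) x : (forall n, 0 < r_ n) ->
  r_ n @[n --> \oo] --> 0 -> Lip_ball f (r_ n) x @[n --> \oo] --> lip f x.
Proof.
move=> r0 r_cvg; apply/cvgrPdist_le => e e0.
have [|r r1 fr] := @lip_lt _ _ f x (lip f x + e) fb; first by rewrite ltrDl.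
move/cvgrPdist_lt: r_cvg => /(_ r r1); apply: filterS => n.
rewrite sub0r normrN => /(le_lt_trans (ler_norm _)) rn.
rewrite distrC ger0_norm ?subr_ge0 ?lip_le_Lip_ball// lerBlDl.
apply: Lip_ball_le => //; first by rewrite addr_ge0 ?lip_ge0// ltW.
by move=> y z yr zr; apply: fr; [apply: le_ball yr|apply: le_ball zr]; exact: ltW.
Qed.

(** Lower semicontinuity: a pair of points of the open ball around [x] lies in
    the balls of the same radius around all points near [x]. *)
Lemma Lip_ball_measurable r : 0 < r ->
  measurable_fun [set: borel X] (Lip_ball f r : borel X -> R).
Proof.
move=> r0; apply: lsc_measurable => c; apply: metric_openP => x /= cx.
have [c0|c0] := ltP c 0.
  by exists 1 => // y _ /=; apply: lt_le_trans c0 _; exact: Lip_ball_ge0.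
have [y [z [xy xz cyz]]] : exists y z, [/\ ball x r y, ball x r z &
    c * mdist y z < `|f y - f z|].
  apply: contrapT => nyz; move: cx; apply/negP; rewrite -leNgt.
  apply: Lip_ball_le => // y z xy xz; rewrite leNgt; apply/negP => cyz.
  by apply: nyz; exists y, z.
pose s := Num.min (r - mdist x y) (r - mdist x z).
have s0 : 0 < s.
  by rewrite lt_min !subr_gt0; move: xy xz; rewrite !ballEmdist /= => -> ->.
exists s => // w; rewrite ballEmdist/= lt_min => /andP[wy wz].
rewrite ltNge; apply/negP => wc.
have /(_ y z) := @Lip_ballP r w _ _ r0.
have wy' : ball w r y.
  by rewrite ballEmdist/=; have := metric_triangle w x y; rewrite (metric_sym w x); lra.
have wz' : ball w r z.
  by rewrite ballEmdist/=; have := metric_triangle w x z; rewrite (metric_sym w x); lra.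
move=> /(_ wy' wz'); apply/negP; rewrite -ltNge; apply: le_lt_trans cyz.
by rewrite ler_wpM2r ?mdist_ge0.
Qed.

Lemma lip_measurable : measurable_fun [set: borel X] (lip f : borel X -> R).
Proof.
have mf n : measurable_fun [set: borel X]
    (Lip_ball f n.+1%:R^-1 : borel X -> R) by exact: Lip_ball_measurable.
apply: (measurable_fun_cvg mf) => x _.
by apply: Lip_ball_cvg => //; exact: cvg_harmonic.
Qed.

End Lip_ball.

End lip_measurable.

(** * Polynomial approximation of the positive part *)

Section polynomial_step.
Context {R : realType}.
Implicit Types (P q : {poly R}) (M s t e : R) (n : nat).

Lemma poly_antiderivative q : exists P, P^`() = q.
Proof.
(* The coefficient of index 0 is [q`_0 / 0], that is 0. *)
exists (\poly_(i < (size q).+1) (q`_i.-1 / i%:R)); apply/polyP => i.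
rewrite coef_deriv coef_poly ltnS; case: ltnP => [_|qi] /=.
  by rewrite -(mulr_natr (q`_i / _)) divfK ?pnatr_eq0.
by rewrite mul0rn nth_default.
Qed.

Lemma mean_value_poly P (a b : R) : a <= b -> exists2 c, a <= c <= b &
  P.[b] - P.[a] = P^`().[c] * (b - a).
Proof.
rewrite le_eqVlt => /predU1P[->|ab].
  by exists b; rewrite ?lexx// !subrr mulr0.
have [c] := polyrcf.poly_mvt P ab.
by rewrite in_itv/= => /andP[ac cb] e; exists c; rewrite ?(ltW ac) ?(ltW cb).
Qed.

Lemma bernoulli (a : R) n : -1 <= a -> 1 + n%:R * a <= (1 + a) ^+ n.
Proof.
move=> a1; elim: n => [|n ih]; first by rewrite mul0r addr0 expr0.
rewrite exprS; apply: le_trans (ler_wpM2l _ ih); last by lra.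
rewrite -natr1 mulrDl mul1r mulrDr mulr1 mulrDl mul1r.
have : 0 <= a * (n%:R * a) by rewrite mulrCA mulr_ge0// -expr2 sqr_ge0.
lra.
Qed.

Lemma expr_one_sub_le (a : R) n : 0 <= a <= 1 -> (1 - a) ^+ n * (1 + n%:R * a) <= 1.
Proof.
move=> /andP[a0 a1].
apply: (@le_trans _ _ ((1 - a) ^+ n * (1 + a) ^+ n)).
  by rewrite ler_wpM2l ?exprn_ge0 ?subr_ge0// bernoulli//; lra.
rewrite -exprMn exprn_ile1//.
- by rewrite mulr_ge0//; lra.
- have : 0 <= a * a by rewrite mulr_ge0.
  lra.
Qed.

(** The polynomials [1 - (1 - t ^+ n) ^+ (2 ^ n)], which Brosowski and Deutsch
    used to prove the Stone-Weierstrass theorem: by Bernoulli's inequality they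
    tend to 0 below [1 / 2] and to 1 above. *)
Lemma poly_unit_step e : 0 < e -> exists q,
  [/\ forall t, 0 <= t <= 1 -> 0 <= q.[t] <= 1,
      forall t, 2^-1 + e <= t <= 1 -> 1 - e <= q.[t] &
      forall t, 0 <= t <= 2^-1 - e -> q.[t] <= e].
Proof.
move=> e0; pose n := (Num.truncn (e^-1 / (2 * e))).+1.
have n_large : 1 < e * (1 + n%:R * (2 * e)).
  rewrite -ltr_pdivrMl// mulr1 -ltrBlDl.
  apply: lt_trans (_ : e^-1 < _); first by rewrite gtrBl.
  rewrite -ltr_pdivrMr ?mulr_gt0//; exact: truncnS_gt.
exists (1 - (1 - 'X^n) ^+ (2 ^ n)).
have qE t : (1 - (1 - 'X^n) ^+ (2 ^ n) : {poly R}).[t] =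
    1 - (1 - t ^+ n) ^+ (2 ^ n) by rewrite !hornerE.
have pow01 t : 0 <= t <= 1 -> 0 <= t ^+ n <= 1.
  by move=> /andP[t0 t1]; rewrite exprn_ge0// exprn_ile1.
split=> t; rewrite qE.
- move=> /pow01/andP[tn0 tn1].
  have : 0 <= (1 - t ^+ n) ^+ (2 ^ n) <= 1.
    by rewrite exprn_ge0 ?exprn_ile1//; lra.
  by move=> /andP[? ?]; apply/andP; split; lra.
- move=> /andP[te t1]; have t0 : 0 <= t by lra.
  rewrite lerD2l lerN2.
  have := @expr_one_sub_le (t ^+ n) (2 ^ n); rewrite pow01 ?t0// => /(_ isT).
  rewrite natrX -exprMn => h.
  have b : 1 + n%:R * (2 * e) <= (2 * t) ^+ n.
    apply: le_trans (bernoulli _ _) _; first by lra.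
    by apply: lerXn2r; rewrite ?nnegrE; lra.
  have A0 : 0 <= (1 - t ^+ n) ^+ (2 ^ n).
    rewrite exprn_ge0// subr_ge0.
    by have /andP[] : 0 <= t ^+ n <= 1 by apply: pow01; rewrite t0.
  have B0 : 0 < 1 + (2 * t) ^+ n by rewrite ltr_pwDl// exprn_ge0//; lra.
  rewrite -(ler_pM2r B0); apply: le_trans h _.
  apply: le_trans (ltW n_large) _; rewrite ler_pM2l//; lra.
- move=> /andP[t0 te]; have t1 : t <= 1 by lra.
  have /andP[tn0 tn1] : 0 <= t ^+ n <= 1 by apply: pow01; rewrite t0.
  have b1 : 1 + (2 ^ n)%:R * - t ^+ n <= (1 + - t ^+ n) ^+ (2 ^ n).
    by apply: bernoulli; lra.
  have b2 : (2 ^ n)%:R * t ^+ n <= (1 - 2 * e) ^+ n.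
    by rewrite natrX -exprMn; apply: lerXn2r; rewrite ?nnegrE; lra.
  have b3 : (1 - 2 * e) ^+ n <= e.
    have B0 : 0 < 1 + n%:R * (2 * e) by rewrite ltr_pwDl// !mulr_ge0// ltW.
    rewrite -(ler_pM2r B0); apply: le_trans (ltW n_large).
    by apply: expr_one_sub_le; lra.
  move: b1; rewrite mulrN; lra.
Qed.

(** Integrate a polynomial step rescaled to the interval from [- M] to [M].
    The bounds 0 and 1 hold exactly for the derivative, so that it can serve as
    a weight in convex combinations of slopes. *)
Lemma poly_positive_part M e : 0 < M -> 0 < e -> exists P,
  [/\ forall s, `|s| <= M -> 0 <= P^`().[s] <= 1,
      forall s, `|s| <= M -> e <= s -> 1 - e <= P^`().[s],
      forall s, `|s| <= M -> s <= - e -> P^`().[s] <= e &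
      forall s, `|s| <= M -> `|P.[s] - Num.max s 0| <= e].
Proof.
move=> M0 e0.
have [dl [dl0 dlM dle]] : exists dl, [/\ 0 < dl, dl <= M & dl * (4 * M + 6) <= e].
  have D0 : 0 < 4 * M + 6 by lra.
  exists (Num.min M (e / (4 * M + 6))); split.
  - by rewrite lt_min M0 divr_gt0.
  - by rewrite ge_min lexx.
  - by rewrite -ler_pdivlMr// ge_min lexx orbT.
(* The errors on the two sides of 0 and at 0 add up to [dl * (4 * M + 6)]. *)
have dle' : dl <= e by apply: le_trans dle; rewrite ler_peMr ?(ltW dl0)//; lra.
have dl2M : 0 < Num.min dl (dl / (2 * M)) by rewrite lt_min dl0 divr_gt0// mulr_gt0.
have [q0 [q01 q0up q0lo]] := poly_unit_step dl2M.
pose q := q0 \Po ((2 * M)^-1 *: ('X + M%:P)).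
have qE s : q.[s] = q0.[(s + M) / (2 * M)].
  by rewrite horner_comp !hornerE mulrC.
have rng s : `|s| <= M -> 0 <= (s + M) / (2 * M) <= 1.
  move=> /ler_normlP[? ?]; rewrite divr_ge0 ?ler_pdivrMr ?mul1r//; lra.
have halfE s : (s + M) / (2 * M) = 2^-1 + s / (2 * M).
  by field; rewrite gt_eqF.
have dl1 : Num.min dl (dl / (2 * M)) <= dl by rewrite ge_min lexx.
have dl2 : Num.min dl (dl / (2 * M)) <= dl / (2 * M) by rewrite ge_min lexx orbT.
have qrange s : `|s| <= M -> 0 <= q.[s] <= 1.
  by move=> sM; rewrite qE; exact/q01/rng.
have qup s : `|s| <= M -> dl <= s -> 1 - dl <= q.[s].
  move=> sM ds; rewrite qE; apply: le_trans (q0up _ _); first by lra.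
  have /andP[_ ->] := rng s sM; rewrite andbT halfE lerD2l.
  by apply: le_trans dl2 _; rewrite ler_pM2r// invr_gt0 mulr_gt0.
have qlo s : `|s| <= M -> s <= - dl -> q.[s] <= dl.
  move=> sM ds; rewrite qE; apply: le_trans (q0lo _ _) _; last by lra.
  have /andP[-> _] := rng s sM; rewrite halfE lerD2l lerNr -mulNr.
  by apply: le_trans dl2 _; rewrite ler_pM2r ?invr_gt0 ?mulr_gt0// lerNr.
have [P0 P0q] := poly_antiderivative q.
pose P := P0 - P0.[- M]%:P.
have Pq : P^`() = q by rewrite derivB derivC subr0.
have PM : P.[- M] = 0 by rewrite !hornerE subrr.
exists P; rewrite Pq; split => // [s sM es|s sM es|s sM].
- by have := qup s sM (le_trans dle' es); lra.
- have sdl : s <= - dl by lra.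
  by have := qlo s sM sdl; lra.
have /andP[s1 s2] : - M <= s <= M by rewrite -ler_norml.
have lo a b : - M <= a -> a <= b -> b <= M -> 0 <= P.[b] - P.[a] <= b - a.
  move=> Ma ab bM; have [c /andP[ac cb] ->] := mean_value_poly P ab.
  rewrite Pq; have /andP[qc0 qc1] : 0 <= q.[c] <= 1.
    by apply: qrange; rewrite ler_norml; lra.
  by rewrite mulr_ge0 ?subr_ge0//= ler_piMl// subr_ge0.
have neg a : - M <= a -> a <= - dl -> P.[a] <= dl * (2 * M).
  move=> Ma adl; have [c /andP[ac cb]] := mean_value_poly P Ma.
  rewrite PM subr0 Pq => ->.
  have cM : `|c| <= M by rewrite ler_norml; lra.
  have := qlo c cM (le_trans cb adl); have /andP[c0 _] := qrange c cM => h.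
  by apply: ler_pM => //; lra.
have Pneg : 0 <= P.[- dl] <= dl * (2 * M).
  rewrite neg ?lexx ?lerN2// andbT.
  by have /andP[] := lo (- M) (- dl) (lexx _) ltac:(lra) ltac:(lra); rewrite PM subr0.
have Pmid a : - dl <= a -> a <= dl -> 0 <= P.[a] <= dl * (2 * M) + 2 * dl.
  move=> da ad; have := lo (- dl) a ltac:(lra) da ltac:(lra).
  by move: Pneg => /andP[? ?] /andP[? ?]; apply/andP; split; lra.
have Mdl : 0 <= dl * M by rewrite mulr_ge0// ltW.
have dle2 : 4 * (dl * M) + 6 * dl <= e by move: dle; lra.
rewrite ler_norml /Num.max; case: ltP => s0.
- have [sd|sd] := leP s (- dl).
    have := neg s s1 sd; have := lo (- M) s (lexx _) s1 s2; rewrite PM.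
    by move=> /andP[? ?] ?; apply/andP; split; lra.
  by have /andP[? ?] := Pmid s (ltW sd) ltac:(lra); apply/andP; split; lra.
- have [sd|sd] := leP s dl.
    by have /andP[? ?] := Pmid s ltac:(lra) sd; apply/andP; split; lra.
  have /andP[? ?] := Pmid dl ltac:(lra) (lexx _).
  have [c /andP[ac cb]] := mean_value_poly P (ltW sd).
  have cM : `|c| <= M by rewrite ler_norml; lra.
  rewrite Pq => e1; have qc := qup c cM ac; have /andP[_ qc1] := qrange c cM.
  have sd0 : 0 <= s - dl by lra.
  have : (1 - dl) * (s - dl) <= q.[c] * (s - dl) by rewrite ler_wpM2r.
  have : q.[c] * (s - dl) <= 1 * (s - dl) by rewrite ler_wpM2r.
  have : dl * (s - dl) <= dl * M by rewrite ler_wpM2l ?(ltW dl0)//; lra.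
  rewrite -e1 mulrBl mul1r => ? ? ?; apply/andP; split; lra.
Qed.

End polynomial_step.

(** * Relaxed slopes *)

Section chain_rule.
Context {R : realType} {X : metricType R}.
Implicit Types (f h : X -> R) (x y z : X).

(** By the mean value theorem the increments of [f - P (f - h)] combine those of
    [f] and [h] with weights [1 - P^`().[c]] and [P^`().[c]], where [c] is near
    [f x - h x]. *)
Lemma lip_sub_poly f h (P : {poly R}) x :
  Lip_b f -> Lip_b h -> Lip_b (fun y => f y - P.[f y - h y]) ->
  0 <= P^`().[f x - h x] <= 1 ->
  lip (fun y => f y - P.[f y - h y]) x <=
    (1 - P^`().[f x - h x]) * lip f x + P^`().[f x - h x] * lip h x.
Proof.
move=> fb hb ub; set t := P^`().[_] => /andP[t0 t1].
set F := lip f x; set H := lip h x.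
have F0 : 0 <= F by exact: lip_ge0.
have H0 : 0 <= H by exact: lip_ge0.
apply/ler_addgt0Pr => e e0.
have D0 : 0 < F + H + 3 by lra.
pose s := Num.min 1 (e / (F + H + 3)).
have s0 : 0 < s by rewrite lt_min ltr01 divr_gt0.
have s1 : s <= 1 by rewrite ge_min lexx.
have se : s * (F + H + 3) <= e by rewrite -ler_pdivlMr// ge_min lexx orbT.
have [|r1 r10 fr] := @lip_lt _ _ f x (F + s) fb; first by rewrite ltrDl.
have [|r2 r20 hr] := @lip_lt _ _ h x (H + s) hb; first by rewrite ltrDl.
have [dl dl0 Pdl] := polyrcf.poly_cont (f x - h x) P^`() s0.
have [L L0 aL] : exists2 L, 0 <= L &
    forall y, `|(f y - h y) - (f x - h x)| <= L * mdist x y.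
  have ab : Lip_b (f \+ (fun y => -1 * h y)) by apply: Lip_bD => //; exact: Lip_bZ.
  have [L L0 aL] := Lip_b_lipschitz ab; exists L => // y.
  by have := aL y x; rewrite /= !mulN1r (metric_sym y x).
have L1 : 0 < L + 1 by rewrite ltr_wpDl.
pose r := Num.min (Num.min r1 r2) (dl / (L + 1)).
have r0 : 0 < r by rewrite !lt_min r10 r20 divr_gt0.
have near y : ball x r y -> `|(f y - h y) - (f x - h x)| < dl.
  rewrite ballEmdist/= lt_min => /andP[_]; rewrite ltr_pdivlMr// => xy.
  apply: le_lt_trans (aL y) _; apply: le_lt_trans xy.
  by rewrite mulrC ler_wpM2l ?mdist_ge0// lerDl.
apply: (@lip_le _ _ _ _ r) => //.
  by rewrite !addr_ge0 ?mulr_ge0 ?subr_ge0// ltW.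
move=> y z xy xz.
have [c cP Pc] : exists2 c, `|P^`().[c] - t| < s &
    P.[f y - h y] - P.[f z - h z] = P^`().[c] * ((f y - h y) - (f z - h z)).
  have := near y xy; have := near z xz.
  move: (f y - h y) (f z - h z) => a b.
  wlog ab : a b / b <= a => [hwlog|].
    have [ba|/ltW ab] := leP b a; first exact: hwlog.
    move=> nb na; have [c cP Pc] := hwlog b a ab na nb.
    by exists c => //; rewrite -opprB Pc -mulrN opprB.
  move=> nb na; have [c /andP[bc ca] ->] := mean_value_poly P ab.
  exists c => //; apply: Pdl.
  by move: na nb; rewrite !ltr_norml; lra.
have -> : f y - P.[f y - h y] - (f z - P.[f z - h z]) =
    (1 - P^`().[c]) * (f y - f z) + P^`().[c] * (h y - h z).
  have -> : P.[f y - h y] = P.[f z - h z] + P^`().[c] * ((f y - h y) - (f z - h z)).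
    by rewrite -Pc; ring.
  by ring.
have fyz : `|f y - f z| <= (F + s) * mdist y z.
  by apply: fr; [apply: le_ball xy|apply: le_ball xz]; rewrite !ge_min lexx.
have hyz : `|h y - h z| <= (H + s) * mdist y z.
  by apply: hr; [apply: le_ball xy|apply: le_ball xz]; rewrite !ge_min lexx !orbT.
have d0 := mdist_ge0 y z.
move: cP; rewrite ltr_norml => /andP[c1 c2].
have n1 : `|1 - P^`().[c]| <= 1 - t + s by rewrite ler_norml; lra.
have n2 : `|P^`().[c]| <= t + s by rewrite ler_norml; lra.
apply: le_trans (ler_normD _ _) _; rewrite !normrM.
apply: (@le_trans _ _ ((1 - t + s) * ((F + s) * mdist y z) +
                       (t + s) * ((H + s) * mdist y z))).
  by apply: lerD; apply: ler_pM.
have -> : (1 - t + s) * ((F + s) * mdist y z) + (t + s) * ((H + s) * mdist y z) =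
  ((1 - t) * F + t * H + s * (1 + F + H + 2 * s)) * mdist y z by ring.
rewrite ler_wpM2r// lerD2l; apply: le_trans se.
by rewrite ler_wpM2l ?(ltW s0)//; lra.
Qed.

Lemma subalgebra_horner (A B : set (X -> R)) (P : {poly R}) f :
  unital_subalgebra B A -> A f -> A (fun x => P.[f x]).
Proof.
move=> [_ A1 AD AZ AM] Af; elim/poly_ind: P => [|P c ih].
  have -> : (fun x => (0 : {poly R}).[f x]) = 0 \*: (cst 1 : X -> R).
    by apply/funext => x; rewrite horner0 /= scale0r.
  exact: AZ.
have -> : (fun x => (P * 'X + c%:P).[f x]) =
    ((fun x => P.[f x]) \* f) \+ (c \*: (cst 1 : X -> R)).
  by apply/funext => x; rewrite !hornerE /= [_ *: 1]mulr1.
by apply: AD; [exact: AM|exact: AZ].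
Qed.

End chain_rule.

#[global] Instance borel_ae_filter (R : realType) (X : completeMetricType R)
  (m : {finite_measure set (borel X) -> \bar R}) : Filter (almost_everywhere m) :=
  ae_filter_ringOfSetsType m.

Section relaxed_slope.
Context {R : realType} {X : completeMetricType R}.
Variable m : {finite_measure set (borel X) -> \bar R}.
Variables (p : R) (p_gt1 : 1 < p).
Implicit Types (A B : set (X -> R)) (f g h : X -> R).
Local Notation Lp := (Lfun m p%:E).
Local Notation N := (Lpnorm m p).
Local Notation rho := (L0dist m).
Local Notation measurableX f := (measurable_fun [set: borel X] (f : borel X -> R)).

(** Any [g'] above [lip f'] is admitted, so that slopes can be enlarged and
    combined convexly. *)
Definition relaxed_slope A f g := [/\ measurableX f, g \in Lp &
  forall e, 0 < e -> exists f' g', [/\ A f', g' \in Lp,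
    forall x, lip f' x <= g' x, rho f' f <= e & N (g' \- g) <= e]].

Lemma lip_Lp f : Lip_b f -> lip f \in Lp.
Proof.
move=> fb; have [L L0 fL] := Lip_b_lipschitz fb.
apply: (@Lp_le _ _ _ _ _ p_gt1 _ (cst L)); first exact: lip_measurable.
  exact: Lp_cst.
by move=> x; rewrite !ger0_norm ?lip_ge0//; exact: lip_le_lipschitz.
Qed.

Lemma L0distxx f : rho f f = 0.
Proof.
rewrite /L0dist -[RHS](mul0r (fine (m setT))) -Rintegral_cst//.
apply: eq_Rintegral => x _; rewrite subrr normr0.
by apply/eqP; rewrite eq_le ge_min lexx min1_ge0.
Qed.

Lemma Lpnorm0 : N (cst 0) = 0.
Proof.
rewrite (_ : cst 0 = (fun x => 0 * (cst 0 : X -> R) x)).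
  by rewrite LpnormZ ?normr0 ?mul0r//; exact: Lp_cst.
by apply/funext => x; rewrite mul0r.
Qed.

Lemma LpnormBxx g : N (g \- g) = 0.
Proof.
by rewrite -Lpnorm0; congr Lpnorm; apply/funext => x /=; rewrite subrr.
Qed.

Lemma relaxed_slope_lip A f : A `<=` Lip_b -> A f -> relaxed_slope A f (lip f).
Proof.
move=> AL Af; have fb := AL _ Af; split; first exact: Lip_b_measurable.
  exact: lip_Lp.
move=> e e0; exists f, (lip f); split => //; first exact: lip_Lp.
- by rewrite L0distxx ltW.
- by rewrite LpnormBxx ltW.
Qed.

Lemma relaxed_slope_sub A B f g : A `<=` B ->
  relaxed_slope A f g -> relaxed_slope B f g.
Proof.
move=> AB [fm gL S]; split => // e /S[f' [g' [? ? ? ? ?]]].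
by exists f', g'; split => //; exact: AB.
Qed.

Lemma relaxed_slope_closed A f g : A `<=` Lip_b -> measurableX f -> g \in Lp ->
  (forall e, 0 < e -> exists f' g', [/\ relaxed_slope A f' g',
    rho f' f <= e & N (g' \- g) <= e]) -> relaxed_slope A f g.
Proof.
move=> AL fm gL cl; split => // e e0.
have e2 : 0 < e / 2 by rewrite divr_gt0.
have [f1 [g1 [[f1m g1L S1] f1f g1g]]] := cl _ e2.
have [f2 [g2 [Af2 g2L l2 f21 g21]]] := S1 _ e2.
exists f2, g2; split => //.
  apply: le_trans (@L0dist_triangle _ _ _ m f1 _ _ _ _ _) _ => //.
    exact: Lip_b_measurable (AL _ Af2).
  lra.
by apply: le_trans (Lpnorm_triangle p_gt1 g2L g1L gL) _; lra.
Qed.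

(** Add the positive part of [h - g] to the approximating slopes. *)
Lemma relaxed_slope_le A f g h : relaxed_slope A f g -> h \in Lp ->
  {ae m, forall x, g x <= h x} -> relaxed_slope A f h.
Proof.
move=> [fm gL S] hL gh; split => // e /S[f' [g' [Af' g'L l' f'f g'g]]].
pose k := (fun x => Num.max (h x) (g x)) \- g.
have kL : k \in Lp.
  by apply: LpB => //; exact: Lp_max.
exists f', (g' \+ k); split => //.
- exact: LpD.
- move=> x /=; apply: le_trans (l' x) _.
  by rewrite lerDl subr_ge0 le_max lexx orbT.
- apply: le_trans g'g; apply: Lpnorm_le_ae => //.
  + by apply: LpB => //; exact: LpD.
  + exact: LpB.
  apply: filterS gh => x ghx; rewrite /k /= (max_idPl ghx).
  by rewrite (_ : g' x + (h x - g x) - h x = g' x - g x)//; ring.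
Qed.

Lemma relaxed_slope_seq_closed A f g (f_ g_ : (X -> R)^nat) : A `<=` Lip_b ->
  measurableX f -> g \in Lp -> (forall n, relaxed_slope A (f_ n) (g_ n)) ->
  {ae m, forall x, f_ n x @[n --> \oo] --> f x} ->
  N (g_ n \- g) @[n --> \oo] --> 0 -> relaxed_slope A f g.
Proof.
move=> AL fm gL S ff gg; apply: relaxed_slope_closed => // e e0.
have fm_ n : measurableX (f_ n) by case: (S n).
have /cvgr0Pnorm_le/(_ e e0) := ae_cvg_L0dist fm_ fm ff.
have /cvgr0Pnorm_le/(_ e e0) := gg.
move=> [n1 _ n1P] [n2 _ n2P]; exists (f_ (maxn n1 n2)), (g_ (maxn n1 n2)).
split => //.
- by apply: le_trans (ler_norm _) (n2P _ _); rewrite /= leq_maxr.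
- by apply: le_trans (ler_norm _) (n1P _ _); rewrite /= leq_maxl.
Qed.

Lemma relaxed_slopeP A f g : A `<=` Lip_b -> relaxed_slope A f g ->
  exists f_ g_ : (X -> R)^nat, [/\ forall n, A (f_ n), forall n, g_ n \in Lp,
    forall n x, lip (f_ n) x <= g_ n x,
    {ae m, forall x, f_ n x @[n --> \oo] --> f x} &
    N (g_ n \- g) @[n --> \oo] --> 0].
Proof.
move=> AL [fm gL S].
have /choice[F FP] : forall n, exists fg : (X -> R) * (X -> R),
  [/\ A fg.1, fg.2 \in Lp, forall x, lip fg.1 x <= fg.2 x,
    rho fg.1 f <= 2^-1 ^+ n & N (fg.2 \- g) <= 2^-1 ^+ n].
  by move=> n; have [f' [g' ?]] := S _ (half_expn_gt0 n); exists (f', g').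
exists (fun n => (F n).1), (fun n => (F n).2); split.
- by move=> n; have [] := FP n.
- by move=> n; have [] := FP n.
- by move=> n; have [] := FP n.
- apply: L0dist_cvg_ae => // n; have [Af _ _ fn _] := FP n => //.
  exact: Lip_b_measurable (AL _ Af).
- apply/cvgr0Pnorm_le => e e0; have [k ke] := half_expn_le e0.
  exists k => // n /= kn; rewrite ger0_norm ?Lpnorm_ge0//.
  by have [_ _ _ _ gn] := FP n; exact: le_trans gn (ke n kn).
Qed.

Lemma relaxed_slope_ge0 A f g : A `<=` Lip_b -> relaxed_slope A f g ->
  {ae m, forall x, 0 <= g x}.
Proof.
move=> AL [fm gL S]; pose k x := Num.max (- g x) 0.
have km : measurableX k.
  by apply: measurable_maxr => //; apply: measurableT_comp => //;
    exact: Lp_measurable gL.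
have kL : k \in Lp.
  apply: (Lp_le p_gt1 km gL) => x; rewrite /k /Num.max.
  by case: ltP => _; rewrite ?normrN ?normr0.
have : N k = 0.
  apply/eqP; rewrite eq_le Lpnorm_ge0 andbT; apply/ler_addgt0Pr => e e0.
  rewrite add0r; have [f' [g' [Af' g'L l' _ g'g]]] := S _ e0.
  apply: le_trans g'g; apply: Lpnorm_le => //; first exact: LpB.
  move=> x /=; have g'0 : 0 <= g' x by apply: le_trans (l' x); exact/lip_ge0/AL.
  rewrite /k /Num.max; case: ltP => h; rewrite ?normr0//.
  by rewrite !ger0_norm; lra.
move=> /(Lpnorm_eq0 p_gt1 kL); apply: filterS => x; rewrite /k.
by move=> /eqP; rewrite eq_le ge_max => /andP[/andP[+ _] _]; rewrite oppr_le0.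
Qed.

End relaxed_slope.

(** * Minima and maxima of relaxed slopes *)

Lemma dist_min_le (R : realType) (a b c d q e : R) :
  `|a - c| <= e / 4 -> `|b - d| <= e / 4 -> `|q - Num.max (c - d) 0| <= e / 4 ->
  `|Num.min a b - (c - q)| <= e.
Proof.
rewrite !ler_norml /Num.min /Num.max => /andP[? ?] /andP[? ?].
by case: ltP => ?; case: ltP => ? /andP[? ?]; apply/andP; split; lra.
Qed.

Section relaxed_slope_lattice.
Context {R : realType} {X : completeMetricType R}.
Variable m : {finite_measure set (borel X) -> \bar R}.
Variables (p : R) (p_gt1 : 1 < p).
Variable A : set (X -> R).
Hypothesis A_alg : unital_subalgebra Lip_b A.
Implicit Types (f g h : X -> R).
Local Notation Lp := (Lfun m p%:E).
Local Notation N := (Lpnorm m p).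
Local Notation S := (relaxed_slope m p A).
Local Notation measurableX f := (measurable_fun [set: borel X] (f : borel X -> R)).

Let AL : A `<=` Lip_b. Proof. by case: A_alg. Qed.

Lemma Lpnorm_norm (u : borel X -> R) : u \in Lp -> N (fun x => `|u x|) = N u.
Proof.
move=> uL; have nL := Lp_norm p_gt1 uL.
apply/eqP; rewrite eq_le; apply/andP; split.
  by apply: (Lpnorm_le p_gt1 (Lp_measurable nL) uL) => x; rewrite normr_id.
by apply: (Lpnorm_le p_gt1 (Lp_measurable uL) nL) => x; rewrite normr_id.
Qed.

Lemma relaxed_slope_affine f g c a : S f g ->
  S (fun x => c + a * f x) (fun x => `|a| * g x).
Proof.
move=> fg; have [fm gL _] := fg.
have [f_ [g_ [Af gL_ l_ ff gg]]] := relaxed_slopeP AL fg.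
have Aaff n : A (fun x => c + a * f_ n x).
  have [_ A1 AD AZ _] := A_alg.
  have -> : (fun x => c + a * f_ n x) = (c \*: (cst 1 : X -> R)) \+ (a \*: f_ n).
    by apply/funext => x /=; rewrite [_ *: 1]mulr1.
  by apply: AD; exact: AZ.
apply: (relaxed_slope_seq_closed p_gt1 (f_ := fun n x => c + a * f_ n x)
  (g_ := fun n x => `|a| * g_ n x)) => //.
- apply: measurable_funD => //; exact: measurable_funM.
- exact: LpZ.
- move=> n; apply: relaxed_slope_le (relaxed_slope_lip _ _ _ (Aaff n)) _ _ => //.
    exact: LpZ.
  apply: aeW => x.
  have -> : (fun x => c + a * f_ n x) = (fun=> c) \+ (fun x => a * f_ n x) by [].
  have fnb := AL (Af n).
  have cb : Lip_b (fun _ : X => c).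
    by split; [exists `|c| => // | exists 0 => y z; rewrite subrr normr0 mul0r].
  apply: le_trans (lipD _ cb (Lip_bZ a fnb)) _; rewrite lip_cst add0r.
  by apply: le_trans (lipZ _ _ fnb) _; rewrite ler_wpM2l.
- apply: filterS ff => x fx; apply: cvgD; first exact: cvg_cst.
  by apply: cvgM => //; exact: cvg_cst.
- have -> : (fun n => N ((fun x => `|a| * g_ n x) \- (fun x => `|a| * g x))) =
      (fun n => `|a| * N (g_ n \- g)).
    apply/funext => n; rewrite -[in RHS](normr_id a) -LpnormZ//; last exact: LpB.
    by congr Lpnorm; apply/funext => x /=; rewrite mulrBr.
  by rewrite -[X in _ --> X](mulr0 `|a|); apply: cvgM => //; exact: cvg_cst.
Qed.

(** Ties take the larger slope: near a point where [f1 = f2], approximations of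
    the minimum may follow either function. *)
Definition slope_min f1 g1 f2 g2 : X -> R := fun x =>
  if f1 x < f2 x then g1 x else
  if f2 x < f1 x then g2 x else Num.max (g1 x) (g2 x).

Lemma slope_min_measurable f1 g1 f2 g2 : measurableX f1 -> measurableX g1 ->
  measurableX f2 -> measurableX g2 -> measurableX (slope_min f1 g1 f2 g2).
Proof.
move=> f1m g1m f2m g2m.
apply: measurable_fun_ifT => //; first exact: measurable_fun_ltr.
apply: measurable_fun_ifT => //; first exact: measurable_fun_ltr.
exact: measurable_maxr.
Qed.

Lemma slope_min_le f1 g1 f2 g2 x :
  `|slope_min f1 g1 f2 g2 x| <= `|g1 x| + `|g2 x|.
Proof.
rewrite /slope_min /Num.max; do 3?case: ifP => _;
  by rewrite ?lerDl ?lerDr.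
Qed.

(** Let [a_ n] and [b_ n] in [A] approximate [f1] and [f2].  The functions
    [a_ n - P (a_ n - b_ n)], with [P] close to the positive part, are in [A]
    and tend to the minimum.  Their slopes are combinations of those of [a_ n]
    and [b_ n]; the weight of the latter tends to 0 where [f1 < f2] and to 1
    where [f2 < f1]. *)
Lemma relaxed_slope_min f1 g1 f2 g2 : S f1 g1 -> S f2 g2 ->
  S (fun x => Num.min (f1 x) (f2 x)) (slope_min f1 g1 f2 g2).
Proof.
move=> S1 S2; have [f1m g1L _] := S1; have [f2m g2L _] := S2.
set G := slope_min f1 g1 f2 g2.
have g1m : measurableX g1 := Lp_measurable g1L.
have g2m : measurableX g2 := Lp_measurable g2L.
have Gm : measurableX G by exact: slope_min_measurable.
pose H x := `|g1 x| + `|g2 x|.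
have HL : H \in Lp := LpD p_gt1 (Lp_norm p_gt1 g1L) (Lp_norm p_gt1 g2L).
have GL : G \in Lp.
  apply: (Lp_le p_gt1 Gm HL) => x.
  by rewrite [leRHS]ger0_norm ?addr_ge0//; exact: slope_min_le.
have [a_ [c_ [Aa cL la aa cc]]] := relaxed_slopeP AL S1.
have [b_ [d_ [Ab dL lb bb dd]]] := relaxed_slopeP AL S2.
have /choice[P PP] : forall n, exists P : {poly R},
    [/\ forall x, 0 <= P^`().[a_ n x - b_ n x] <= 1,
      forall x, 2^-1 ^+ n <= a_ n x - b_ n x ->
        1 - 2^-1 ^+ n <= P^`().[a_ n x - b_ n x],
      forall x, a_ n x - b_ n x <= - 2^-1 ^+ n ->
        P^`().[a_ n x - b_ n x] <= 2^-1 ^+ n &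
      forall x, `|P.[a_ n x - b_ n x] - Num.max (a_ n x - b_ n x) 0| <= 2^-1 ^+ n].
  move=> n; have [[Ma aM] _] := AL (Aa n); have [[Mb bM] _] := AL (Ab n).
  have M0 : 0 < `|Ma| + `|Mb| + 1 by rewrite ltr_wpDl ?addr_ge0.
  have [P [P1 P2 P3 P4]] := poly_positive_part M0 (half_expn_gt0 n).
  have abM x : `|a_ n x - b_ n x| <= `|Ma| + `|Mb| + 1.
    apply: le_trans (ler_normB _ _) _.
    apply: (@le_trans _ _ (`|Ma| + `|Mb|)); last by rewrite lerDl.
    by apply: lerD; [apply: le_trans (aM x) _|apply: le_trans (bM x) _]; exact: ler_norm.
  by exists P; split=> x; [exact: P1|exact: P2|exact: P3|exact: P4].
have Aab n : A (a_ n \+ (-1 \*: b_ n)).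
  by have [_ _ AD AZ _] := A_alg; apply: AD => //; exact: AZ.
have abE n x : (a_ n \+ (-1 \*: b_ n)) x = a_ n x - b_ n x.
  by rewrite /= scaleN1r.
pose t n x := (P n)^`().[a_ n x - b_ n x].
have At n : A (t n).
  have := subalgebra_horner (P n)^`() A_alg (Aab n).
  by congr A; apply/funext => x; rewrite abE.
pose u n x := a_ n x - (P n).[a_ n x - b_ n x].
have Au n : A (u n).
  have [_ _ AD AZ _] := A_alg.
  have := AD _ _ (Aa n) (AZ (-1) _ (subalgebra_horner (P n) A_alg (Aab n))).
  by congr A; apply/funext => x; rewrite /= scaleN1r scaleN1r.
pose w n x := Num.max (G x) ((1 - t n x) * g1 x + t n x * g2 x).
have t01 n x : 0 <= t n x <= 1 by have [h _ _ _] := PP n; exact: h.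
have wm n : measurableX (w n).
  have tm : measurableX (t n) by exact: Lip_b_measurable (AL (At n)).
  apply: measurable_maxr => //; apply: measurable_funD; apply: measurable_funM => //.
  exact: measurable_funB.
have wH n x : `|w n x| <= H x.
  have /andP[t0 t1] := t01 n x.
  rewrite /w /Num.max; case: ltP => _; last exact: slope_min_le.
  apply: le_trans (ler_normD _ _) _; rewrite !normrM lerD//.
    by rewrite ler_piMl// ger0_norm ?subr_ge0//; lra.
  by rewrite ler_piMl// ger0_norm.
have wG : {ae m, forall x, w n x @[n --> \oo] --> G x}.
  apply: filterS2 aa bb => x ax bx.
  have abx : a_ n x - b_ n x @[n --> \oo] --> f1 x - f2 x by exact: cvgB.
  pose D := `|g1 x - g2 x|.
  have D0 : 0 <= D by exact: normr_ge0.
  have bound : \forall n \near \oo, `|G x - w n x| <= 2^-1 ^+ n * D.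
    have [lt12|lt21|eq12] := ltgtP (f1 x) (f2 x).
    - pose k := (f2 x - f1 x) / 2.
      have k0 : 0 < k by rewrite divr_gt0// subr_gt0.
      move/cvgrPdist_lt : abx => /(_ k k0).
      move/cvgr0Pnorm_lt : (@cvg_half_expn R) => /(_ k k0).
      apply: filterS2 => n; rewrite ger0_norm ?(ltW (half_expn_gt0 n))// => nk.
      rewrite ltr_norml => /andP[abk _].
      have abn : a_ n x - b_ n x <= - 2^-1 ^+ n.
        by move: abk nk; rewrite /k; move: (2^-1 ^+ n) => hn; lra.
      have th : t n x <= 2^-1 ^+ n by have [_ _ h _] := PP n; exact: h.
      have /andP[t0 t1] := t01 n x.
      have -> : G x = g1 x by rewrite /G /slope_min lt12.
      have e1 : (1 - t n x) * g1 x + t n x * g2 x = g1 x - t n x * (g1 x - g2 x).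
        by ring.
      rewrite /w /G /slope_min lt12 e1 distrC; apply: (@le_trans _ _ (t n x * D)).
        rewrite /Num.max; case: ltP => _.
          by rewrite addrAC subrr add0r normrN normrM ger0_norm.
        by rewrite subrr normr0 mulr_ge0.
      by rewrite ler_wpM2r.
    - pose k := (f1 x - f2 x) / 2.
      have k0 : 0 < k by rewrite divr_gt0// subr_gt0.
      move/cvgrPdist_lt : abx => /(_ k k0).
      move/cvgr0Pnorm_lt : (@cvg_half_expn R) => /(_ k k0).
      apply: filterS2 => n; rewrite ger0_norm ?(ltW (half_expn_gt0 n))// => nk.
      rewrite ltr_norml => /andP[_ abk].
      have abn : 2^-1 ^+ n <= a_ n x - b_ n x.
        by move: abk nk; rewrite /k; move: (2^-1 ^+ n) => hn; lra.
      have th : 1 - 2^-1 ^+ n <= t n x by have [_ h _ _] := PP n; exact: h.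
      have /andP[t0 t1] := t01 n x.
      have GE : G x = g2 x by rewrite /G /slope_min lt21 ltNge (ltW lt21).
      have e1 : (1 - t n x) * g1 x + t n x * g2 x =
          g2 x + (1 - t n x) * (g1 x - g2 x) by ring.
      rewrite /w GE e1 distrC; apply: (@le_trans _ _ ((1 - t n x) * D)).
        rewrite /Num.max; case: ltP => _.
          by rewrite addrAC subrr add0r normrM ger0_norm ?subr_ge0.
        by rewrite subrr normr0 mulr_ge0 ?subr_ge0.
      by rewrite ler_wpM2r//; lra.
    - apply: nearW => n; have /andP[t0 t1] := t01 n x.
      have GE : G x = Num.max (g1 x) (g2 x) by rewrite /G /slope_min eq12 ltxx.
      have h1 : g1 x <= G x by rewrite GE le_max lexx.
      have h2 : g2 x <= G x by rewrite GE le_max lexx orbT.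
      have h3 : (1 - t n x) * g1 x + t n x * g2 x <= G x.
        have -> : G x = (1 - t n x) * G x + t n x * G x by ring.
        by apply: lerD; rewrite ler_wpM2l ?subr_ge0.
      by rewrite /w (max_idPl h3) subrr normr0 mulr_ge0 ?(ltW (half_expn_gt0 n)).
  apply/cvgrPdist_le => e e0.
  have : 2^-1 ^+ n * D @[n --> \oo] --> 0.
    rewrite -[X in _ --> X](mul0r D).
    by apply: cvgM; [exact: cvg_half_expn|exact: cvg_cst].
  move=> /cvgr0Pnorm_le/(_ e e0); apply: filterS2 bound => n bn.
  rewrite ger0_norm ?mulr_ge0 ?(ltW (half_expn_gt0 n))// => ne.
  exact: le_trans bn ne.
have [_ wN] := Lpnorm_dominated_cvg p_gt1 wm Gm HL wH wG.
have wL n : w n \in Lp.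
  apply: (Lp_le p_gt1 (wm n) HL) => x.
  by apply: le_trans (wH n x) (ler_norm _).
pose E n x := `|(c_ n \- g1) x| + `|(d_ n \- g2) x|.
have EL n : E n \in Lp.
  by apply: LpD => //; apply: Lp_norm => //; exact: LpB.
have EN : N (E n) @[n --> \oo] --> 0.
  apply: (@squeeze_cvgr _ _ _ _ (cst 0) (fun n => N (c_ n \- g1) + N (d_ n \- g2))).
  - apply: nearW => n; rewrite Lpnorm_ge0/=.
    apply: le_trans (LpnormD _ _ _) _ => //; do ?[exact/Lp_norm/LpB];
      by rewrite ?Lpnorm_norm//; exact: LpB.
  - exact: cvg_cst.
  - by rewrite -[X in _ --> X](addr0 0); exact: cvgD.
apply: (relaxed_slope_seq_closed p_gt1 (f_ := u) (g_ := fun n => w n \+ E n)) => //.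
- exact: measurable_minr.
- move=> n; apply: relaxed_slope_le (relaxed_slope_lip _ _ _ (Au n)) _ _ => //.
    exact: LpD.
  apply: aeW => x.
  apply: le_trans (lip_sub_poly (AL (Aa n)) (AL (Ab n)) (AL (Au n)) (t01 n x)) _.
  rewrite -/(t n x); have /andP[t0 t1] := t01 n x.
  have l1 : (1 - t n x) * lip (a_ n) x <= (1 - t n x) * g1 x + `|(c_ n \- g1) x|.
    apply: (@le_trans _ _ ((1 - t n x) * (g1 x + `|c_ n x - g1 x|))).
      rewrite ler_wpM2l ?subr_ge0//; apply: le_trans (la n x) _.
      by rewrite -lerBlDl ler_norm.
    by rewrite mulrDr lerD2l ler_piMl//; lra.
  have l2 : t n x * lip (b_ n) x <= t n x * g2 x + `|(d_ n \- g2) x|.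
    apply: (@le_trans _ _ (t n x * (g2 x + `|d_ n x - g2 x|))).
      rewrite ler_wpM2l//; apply: le_trans (lb n x) _.
      by rewrite -lerBlDl ler_norm.
    by rewrite mulrDr lerD2l ler_piMl.
  apply: le_trans (lerD l1 l2) _; rewrite addrACA lerD2r.
  by rewrite /w le_max lexx orbT.
- apply: filterS2 aa bb => x ax bx.
  have abx : a_ n x - b_ n x @[n --> \oo] --> f1 x - f2 x by exact: cvgB.
  apply/cvgrPdist_le => e e0.
  have e4 : 0 < e / 4 by rewrite divr_gt0.
  move/cvgrPdist_le : ax => /(_ _ e4) nax; move/cvgrPdist_le : bx => /(_ _ e4) nbx.
  move/cvgr0Pnorm_le : (@cvg_half_expn R) => /(_ _ e4) nh.
  near=> n.
  have fa : `|f1 x - a_ n x| <= e / 4 by near: n.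
  have fb : `|f2 x - b_ n x| <= e / 4 by near: n.
  have hn : 2^-1 ^+ n <= e / 4.
    by apply: le_trans (ler_norm _) _; near: n.
  have [_ _ _ /(_ x) Pn] := PP n.
  exact: dist_min_le fa fb (le_trans Pn hn).
- apply: (@squeeze_cvgr _ _ _ _ (cst 0) (fun n => N (w n \- G) + N (E n))).
  + apply: nearW => n; rewrite Lpnorm_ge0/=.
    have -> : (w n \+ E n) \- G = (w n \- G) \+ E n.
      by apply/funext => x /=; rewrite addrAC.
    by apply: LpnormD => //; exact: LpB.
  + exact: cvg_cst.
  + by rewrite -[X in _ --> X](addr0 0); exact: cvgD.
Unshelve. all: by end_near. Qed.

Lemma relaxed_slope_max f1 g1 f2 g2 : S f1 g1 -> S f2 g2 ->
  S (fun x => Num.max (f1 x) (f2 x)) (slope_min (\- f1) g1 (\- f2) g2).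
Proof.
move=> S1 S2.
have neg f g : S f g -> S (\- f) g.
  move=> /(relaxed_slope_affine 0 (-1)); rewrite normrN1.
  by congr relaxed_slope; apply/funext => x /=; rewrite ?mul1r// mulN1r add0r.
have := neg _ _ (relaxed_slope_min (neg _ _ S1) (neg _ _ S2)).
congr relaxed_slope; apply/funext => x /=.
by rewrite oppr_min !opprK.
Qed.

End relaxed_slope_lattice.

(** * Relaxed gradients and minimal slopes *)

Section minimal_slope.
Context {R : realType} {X : completeMetricType R}.
Variable m : {finite_measure set (borel X) -> \bar R}.
Variables (p : R) (p_gt1 : 1 < p).
Variable A : set (X -> R).
Hypothesis AL : A `<=` Lip_b.
Hypothesis A_lin : forall (s t : R) f g, A f -> A g ->
  A (fun x => s * f x + t * g x).
Implicit Types (f g h : X -> R).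
Local Notation Lp := (Lfun m p%:E).
Local Notation N := (Lpnorm m p).
Local Notation S := (relaxed_slope m p A).
Local Notation rho := (L0dist m).
Local Notation measurableX f := (measurable_fun [set: borel X] (f : borel X -> R)).

Lemma lip_lin (s t : R) f g x : Lip_b f -> Lip_b g ->
  lip (fun x => s * f x + t * g x) x <= `|s| * lip f x + `|t| * lip g x.
Proof.
move=> fb gb; apply: le_trans (lipD _ (Lip_bZ s fb) (Lip_bZ t gb)) _.
by apply: lerD; exact: lipZ.
Qed.

(** Mazur's lemma is applied to the slopes of those [f'] in [A] that are, at
    every point, as close to [f] as the tail of an a.e. convergent subsequence.
    Unlike closeness in measure, this is a convex condition on [f']. *)
Lemma relaxed_gradient_slope f G : measurableX f ->
  relaxed_gradient m p A f G -> S f G.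
Proof.
move=> fm [GL [fn [G' [Afn fcvg [lL G'L weak] G'G]]]].
have fnm n : measurableX (fn n) := Lip_b_measurable (AL (Afn n)).
suff SG' : S f G' by exact: relaxed_slope_le SG' GL G'G.
have /cvgr0Pnorm_le rho0 := cvg_in_measure_L0dist fnm fm fcvg.
have /choice[phi phiP] : forall k, exists n, (k <= n)%N /\ rho (fn n) f <= 2^-1 ^+ k.
  move=> k; have [n0 _ n0P] := rho0 _ (half_expn_gt0 k).
  exists (maxn k n0); split; first exact: leq_maxl.
  by apply: le_trans (ler_norm _) (n0P _ _); rewrite /= leq_maxr.
pose h k := fn (phi k).
have haf : {ae m, forall x, h n x @[n --> \oo] --> f x}.
  apply: L0dist_cvg_ae => // n; first exact: fnm.
  by have [] := phiP n.
have phi_cvg : phi n @[n --> \oo] --> \oo.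
  by apply/cvgnyPge => M; exists M => // n /= Mn; apply: leq_trans Mn _;
    have [] := phiP n.
(* The bound by every constant [c] that dominates the tail avoids suprema. *)
pose C n : set (borel X -> R) := [set g' | g' \in Lp /\ exists f', [/\ A f',
  forall x, lip f' x <= g' x & forall x c,
    (forall k, (n <= k)%N -> `|h k x - f x| <= c) -> `|f' x - f x| <= c]].
have /choice[F FP] : forall n, exists fg : (X -> R) * (X -> R), [/\ A fg.1,
    fg.2 \in Lp, forall x, lip fg.1 x <= fg.2 x,
    forall x c, (forall k, (n <= k)%N -> `|h k x - f x| <= c) ->
      `|fg.1 x - f x| <= c & N (fg.2 \- G') <= 2^-1 ^+ n].
  move=> n; have [|u v s t|k||u [uL [f' [Af' l' f'f]]] uG] :=
      @mazur _ _ _ m _ p_gt1 (C n) (fun k => lip (h (k + n)%N)) G'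
        _ _ _ _ _ (half_expn_gt0 n).
  - by move=> u [].
  - move=> [uL [f1 [Af1 l1 f1f]]] [vL [f2 [Af2 l2 f2f]]] s0 t0 st; split.
      by apply: LpD => //; exact: LpZ.
    exists (fun x => s * f1 x + t * f2 x); split; first exact: A_lin.
      move=> x; apply: le_trans (lip_lin _ _ _ (AL Af1) (AL Af2)) _.
      by rewrite !ger0_norm//; apply: lerD; rewrite ler_wpM2l.
    move=> x c hc; have c1 := f1f x c hc; have c2 := f2f x c hc.
    have -> : s * f1 x + t * f2 x - f x = s * (f1 x - f x) + t * (f2 x - f x).
      by rewrite -[f x in LHS]mul1r -st; ring.
    apply: le_trans (ler_normD _ _) _; rewrite !normrM (ger0_norm s0) (ger0_norm t0).
    have -> : c = s * c + t * c by rewrite -mulrDl st mul1r.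
    by apply: lerD; rewrite ler_wpM2l.
  - split; first exact: lL.
    exists (h (k + n)%N); split => //; first exact: Afn.
    by move=> x c; apply; exact: leq_addl.
  - split => //; first by move=> k; exact: lL.
    move=> psi psid; have := cvg_comp _ _ phi_cvg (weak psi psid).
    by rewrite -(cvg_shiftn n).
  - by exists (f', u).
apply: (relaxed_slope_seq_closed p_gt1 (f_ := fun n => (F n).1)
  (g_ := fun n => (F n).2)) => //.
- move=> n; have [Af1 F2L l1 _ _] := FP n.
  by apply: relaxed_slope_le (relaxed_slope_lip _ _ AL Af1) F2L _ => //; exact: aeW.
- apply: filterS haf => x hx; apply/cvgrPdist_le => e e0.
  move/cvgrPdist_le : hx => /(_ e e0)[n0 _ n0P]; exists n0 => // n /= n0n.
  have [_ _ _ Fc _] := FP n; rewrite distrC; apply: Fc => k nk.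
  by rewrite distrC; apply: n0P; exact: leq_trans nk.
- apply/cvgr0Pnorm_le => e e0; have [k ke] := half_expn_le e0.
  exists k => // n /= kn; rewrite ger0_norm ?Lpnorm_ge0//.
  by have [_ _ _ _ gn] := FP n; exact: le_trans gn (ke n kn).
Qed.

Lemma relaxed_slope_midpoint f g h : S f g -> S f h ->
  S f (fun x => 2^-1 * (g \+ h) x).
Proof.
move=> S1 S2; have [fm gL _] := S1; have [_ hL _] := S2.
have [a_ [c_ [Aa cL la aa cc]]] := relaxed_slopeP AL S1.
have [b_ [d_ [Ab dL lb bb dd]]] := relaxed_slopeP AL S2.
have Am n : A (fun x => 2^-1 * a_ n x + 2^-1 * b_ n x) by exact: A_lin.
apply: (relaxed_slope_seq_closed p_gt1
  (f_ := fun n x => 2^-1 * a_ n x + 2^-1 * b_ n x)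
  (g_ := fun n x => 2^-1 * (c_ n \+ d_ n) x)) => //.
- by apply: LpZ => //; exact: LpD.
- move=> n; apply: relaxed_slope_le (relaxed_slope_lip _ _ AL (Am n)) _ _ => //.
    by apply: LpZ => //; exact: LpD.
  apply: aeW => x; apply: le_trans (lip_lin _ _ _ (AL (Aa n)) (AL (Ab n))) _.
  by rewrite ger0_norm ?invr_ge0// -mulrDr ler_pM2l ?invr_gt0// lerD.
- apply: filterS2 aa bb => x ax bx.
  have -> : f x = 2^-1 * f x + 2^-1 * f x by field.
  by apply: cvgD; apply: cvgM => //; exact: cvg_cst.
- apply: (@squeeze_cvgr _ _ _ _ (cst 0) (fun n => N (c_ n \- g) + N (d_ n \- h))).
  + apply: nearW => n; rewrite Lpnorm_ge0/=.
    have -> : (fun x => 2^-1 * (c_ n \+ d_ n) x) \- (fun x => 2^-1 * (g \+ h) x) =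
        (fun x => 2^-1 * ((c_ n \- g) \+ (d_ n \- h)) x).
      by apply/funext => x /=; ring.
    have L1 : (c_ n \- g) \in Lp by exact: LpB.
    have L2 : (d_ n \- h) \in Lp by exact: LpB.
    rewrite LpnormZ//; last exact: LpD.
    apply: le_trans (LpnormD p_gt1 L1 L2).
    by rewrite ler_piMl ?Lpnorm_ge0// ger0_norm ?invr_ge0// invf_le1// ler1n.
  + exact: cvg_cst.
  + by rewrite -[X in _ --> X](addr0 0); exact: cvgD.
Qed.

(** The midpoint of two minimal slopes is a relaxed slope, hence not shorter,
    and uniform convexity applies. *)
Lemma minimal_slope_unique f g h : S f g -> S f h ->
  (forall k, S f k -> N g <= N k) -> (forall k, S f k -> N h <= N k) ->
  N (g \- h) = 0.
Proof.
move=> Sg Sh ming minh; have [fm gL _] := Sg; have [_ hL _] := Sh.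
have gh : N g = N h by apply/eqP; rewrite eq_le ming// minh.
apply/eqP; rewrite eq_le Lpnorm_ge0 andbT; apply/ler_addgt0Pr => e e0.
rewrite add0r.
have [dl dl0 uc] := Lp_unif_convex m p_gt1 (Lpnorm_ge0 m p g) e0.
have ngL := Lp_norm p_gt1 gL; have nhL := Lp_norm p_gt1 hL.
have Sabs k : S f k -> S f (fun x => `|k x|).
  move=> Sk; have [_ kL _] := Sk; apply: relaxed_slope_le Sk (Lp_norm p_gt1 kL) _ => //.
  by apply: aeW => x; exact: ler_norm.
have := uc _ _ ngL nhL (fun x => normr_ge0 (g x)) (fun x => normr_ge0 (h x)).
rewrite !Lpnorm_norm// -gh lerDl (ltW dl0) => /(_ isT isT) H.
apply: (@le_trans _ _ (N ((fun x => `|g x|) \- (fun x => `|h x|)))).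
  apply: Lpnorm_le_ae => //; [exact: LpB|exact: LpB|].
  apply: filterS2 (relaxed_slope_ge0 p_gt1 AL Sg) (relaxed_slope_ge0 p_gt1 AL Sh).
  by move=> x g0 h0 /=; rewrite (ger0_norm g0) (ger0_norm h0).
apply: H; apply: (@le_trans _ _ (N g)); first by rewrite gerBl ltW.
by apply: ming; apply: relaxed_slope_midpoint; exact: Sabs.
Qed.

(** [K] is the lower semicontinuous relaxation at [f] of the norm of [lip] on
    [A].  A sequence that realizes it has Cauchy slopes: midpoints of its terms
    still approximate [f], so the norms of their slopes are almost [K]. *)
Lemma minimal_slope_exists f g : S f g -> exists (f_ : (X -> R)^nat) G,
  [/\ forall n, A (f_ n), forall n, rho (f_ n) f <= 2^-1 ^+ n,
      N (lip (f_ n) \- G) @[n --> \oo] --> 0, S f G &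
      forall h, S f h -> N G <= N h].
Proof.
move=> Sg; have [fm gL _] := Sg.
pose E := [set c | 0 <= c /\ forall dl, 0 < dl ->
  exists f', [/\ A f', rho f' f <= dl & N (lip f') <= c]].
have SE h e : S f h -> 0 < e -> E (N h + e).
  move=> [_ hL Sh] e0; split; first by rewrite addr_ge0 ?Lpnorm_ge0// ltW.
  move=> dl dl0; have me : 0 < Num.min dl e by rewrite lt_min dl0.
  have [f' [g' [Af' g'L l' ff' gg']]] := Sh _ me.
  have fb := AL Af'.
  exists f'; split => //; first by apply: le_trans ff' _; rewrite ge_min lexx.
  apply: (@le_trans _ _ (N g')).
    apply: (Lpnorm_le p_gt1 (lip_measurable fb) g'L) => x.
    by rewrite ger0_norm ?lip_ge0//; apply: le_trans (l' x) (ler_norm _).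
  apply: le_trans (Lpnorm_le_add p_gt1 g'L hL) _.
  by rewrite lerD2l; apply: le_trans gg' _; rewrite ge_min lexx orbT.
have Elb : has_lbound E by exists 0 => c [].
have Ene : E !=set0 by exists (N g + 1); exact: SE.
pose K := inf E.
have K0 : 0 <= K by apply: lb_le_inf => // c [].
have KN h : S f h -> K <= N h.
  by move=> Sh; apply/ler_addgt0Pr => e e0; apply: ge_inf => //; exact: SE.
have /choice[f_ f_P] : forall n, exists f', [/\ A f', rho f' f <= 2^-1 ^+ n &
    N (lip f') <= K + 2^-1 ^+ n].
  move=> n; have [c [c0 Ec] cK] := @inf_adherent _ E _ (half_expn_gt0 n) (conj Ene Elb).
  have [f' [Af' ff' lf']] := Ec _ (half_expn_gt0 n); exists f'; split => //.
  exact: le_trans lf' (ltW cK).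
have Af n : A (f_ n) by have [] := f_P n.
have fL n : lip (f_ n) \in Lp := lip_Lp m p_gt1 (AL (Af n)).
have f_m n : measurableX (f_ n) := Lip_b_measurable (AL (Af n)).
have [G GL Gcvg] : exists2 G, G \in Lp & N (lip (f_ n) \- G) @[n --> \oo] --> 0.
  apply: (@Lp_complete _ _ _ m p p_gt1 (fun n => lip (f_ n))) => // e e0.
  have [dl dl0 uc] := Lp_unif_convex m p_gt1 K0 e0.
  have [d' d'0 lower] : exists2 d', 0 < d' &
      forall f', A f' -> rho f' f <= d' -> K - dl <= N (lip f').
    have [Kdl|Kdl] := leP (K - dl) 0.
      by exists 1 => // f' _ _; exact: le_trans Kdl (Lpnorm_ge0 _ _ _).
    apply: contrapT => nd.
    have : K <= K - dl.
      apply: ge_inf => //; split; first exact: ltW.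
      move=> d1 d10; apply: contrapT => nf; apply: nd; exists d1 => // f' Af' ff'.
      rewrite leNgt; apply/negP => lt; apply: nf.
      by exists f'; split => //; exact: ltW.
    by lra.
  have md : 0 < Num.min dl (d' / 2) by rewrite lt_min dl0 divr_gt0.
  have [k kmin] := half_expn_le md.
  have half_le i : (k <= i)%N -> 2^-1 ^+ i <= dl /\ 2^-1 ^+ i <= d' / 2.
    by move=> /kmin; rewrite le_min => /andP[].
  exists k => i j ki kj.
  have [idl id'] := half_le i ki; have [jdl jd'] := half_le j kj.
  have [_ ri li] := f_P i; have [_ rj lj] := f_P j.
  have bi := AL (Af i); have bj := AL (Af j).
  apply: uc => //.
  - by move=> x; exact: lip_ge0.
  - by move=> x; exact: lip_ge0.
  - by apply: le_trans li _; rewrite lerD2l.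
  - by apply: le_trans lj _; rewrite lerD2l.
  have Am : A (fun x => 2^-1 * (f_ i \+ f_ j) x).
    have := A_lin 2^-1 2^-1 (Af i) (Af j).
    by congr A; apply/funext => x /=; rewrite mulrDr.
  apply: le_trans (lower _ Am _) _.
    apply: le_trans (L0dist_midpoint _ (f_m i) (f_m j) fm) _.
    lra.
  have sL : (fun x => 2^-1 * (lip (f_ i) \+ lip (f_ j)) x) \in Lp.
    by apply: LpZ => //; exact: LpD.
  apply: (Lpnorm_le p_gt1 (lip_measurable (AL Am)) sL) => x.
  rewrite ger0_norm; last exact/lip_ge0/AL.
  by apply: le_trans (lip_midpoint _ bi bj) (ler_norm _).
exists f_, G; split => //; first by move=> n; have [] := f_P n.
- apply: (relaxed_slope_seq_closed p_gt1 (f_ := f_) (g_ := fun n => lip (f_ n))) => //.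
    by move=> n; exact: relaxed_slope_lip.
  by apply: L0dist_cvg_ae => // n; have [] := f_P n.
- move=> h Sh; apply: le_trans (KN _ Sh).
  apply/ler_addgt0Pr => e e0; have e2 : 0 < e / 2 by rewrite divr_gt0.
  have [k ke] := half_expn_le e2.
  have /cvgr0Pnorm_le/(_ _ e2)[n1 _ n1P] := Gcvg.
  pose n := maxn k n1; have [_ _ ln] := f_P n.
  have nN : N (lip (f_ n) \- G) <= e / 2.
    by apply: le_trans (ler_norm _) (n1P _ _); rewrite /= leq_maxr.
  apply: le_trans (Lpnorm_le_add p_gt1 GL (fL n)) _.
  rewrite LpnormB//.
  have := ke n (leq_maxl _ _); lra.
Qed.

Lemma minimal_relaxed_gradient_slope f g : S f g ->
  is_minimal_relaxed_gradient m p A f (minimal_relaxed_gradient m p A f) /\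
  (S f (minimal_relaxed_gradient m p A f) /\
   forall h, S f h -> N (minimal_relaxed_gradient m p A f) <= N h).
Proof.
move=> Sg; have [f_ [G [Af rf lG SG Gmin]]] := minimal_slope_exists Sg.
have [fm GL _] := SG.
have f_m n : measurableX (f_ n) := Lip_b_measurable (AL (Af n)).
have fL n : lip (f_ n) \in Lp := lip_Lp m p_gt1 (AL (Af n)).
have Gstrong : relaxed_gradient m p A f G.
  split => //; exists f_, G; split => //; last exact: aeW.
    apply: L0dist_cvg_in_measure => //.
    by apply: ae_cvg_L0dist => //; exact: L0dist_cvg_ae.
  split => // phi [lin [C phiC]]; apply/cvgrPdist_le => e e0.
  have C1 : 0 < `|C| + 1 by rewrite ltr_wpDl.
  have /cvgr0Pnorm_le/(_ _ (divr_gt0 e0 C1)) := lG.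
  apply: filterS => n; rewrite ger0_norm ?Lpnorm_ge0// => nG.
  have := lin (-1) G (lip (f_ n)) GL (fL n).
  have dL : ((-1 \*: G) \+ lip (f_ n)) \in Lp.
    by apply: LpD => //; exact: LpZ.
  have := phiC _ dL; rewrite -(LpnormE p_gt1 dL) -EFinM lee_fin => le1 e1.
  rewrite distrC (_ : phi _ - phi G = phi ((-1 \*: G) \+ lip (f_ n))); last first.
    by rewrite e1 mulN1r addrC.
  apply: le_trans le1 _.
  have -> : N ((-1 \*: G) \+ lip (f_ n)) = N (lip (f_ n) \- G).
    by congr Lpnorm; apply/funext => x /=; rewrite scaleN1r addrC.
  move: nG; rewrite ler_pdivlMr// mulrC; apply: le_trans.
  rewrite ler_wpM2r ?Lpnorm_ge0//; apply: le_trans (ler_norm C) _.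
  by rewrite lerDl.
have Gm : is_minimal_relaxed_gradient m p A f G.
  split => // H RH; have SH := relaxed_gradient_slope fm RH.
  have [_ HL _] := SH.
  by rewrite -(LpnormE p_gt1 GL) -(LpnormE p_gt1 HL) lee_fin; exact: Gmin.
have mm : is_minimal_relaxed_gradient m p A f (minimal_relaxed_gradient m p A f).
  exact: (@xgetI _ _ [set H | is_minimal_relaxed_gradient m p A f H] _ Gm).
split => //; move: mm => [Rm minm].
have Sm := relaxed_gradient_slope fm Rm; split => // h Sh.
apply: le_trans (Gmin _ Sh); have [_ mL _] := Sm.
by have := minm _ Gstrong; rewrite -(LpnormE p_gt1 GL) -(LpnormE p_gt1 mL) lee_fin.
Qed.

End minimal_slope.

(** * Infimal convolution with the distance functions *)

Section hopf_lax.
Context {R : realType} {X : completeMetricType R}.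
Variable m : {finite_measure set (borel X) -> \bar R}.
Variables (p : R) (p_gt1 : 1 < p).
Variable A : set (X -> R).
Hypothesis A_alg : unital_subalgebra Lip_b A.
Implicit Types (f g h : X -> R).
Local Notation Lp := (Lfun m p%:E).
Local Notation N := (Lpnorm m p).
Local Notation S := (relaxed_slope m p A).
Local Notation measurableX f := (measurable_fun [set: borel X] (f : borel X -> R)).

Let AL : A `<=` Lip_b. Proof. by case: A_alg. Qed.

Lemma relaxed_slope_bounded_cvg (f_ g_ : (X -> R)^nat) f g (C : R) :
  (forall n, S (f_ n) (g_ n)) -> measurableX f -> measurableX g ->
  (forall n x, `|g_ n x| <= C) ->
  (forall x, f_ n x @[n --> \oo] --> f x) ->
  (forall x, g_ n x @[n --> \oo] --> g x) -> S f g.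
Proof.
move=> Sn fm gm gC ff gg.
have gm_ n : measurableX (g_ n) by have [_ /Lp_measurable] := Sn n.
have gae : {ae m, forall x, g_ n x @[n --> \oo] --> g x} by exact: aeW.
have [gL gN] := @Lpnorm_dominated_cvg _ _ _ m p p_gt1 g_ g (cst C) gm_ gm
  (Lp_cst m p C) gC gae.
by apply: relaxed_slope_seq_closed gN => //; exact: aeW.
Qed.

(** The maximum [h] is recorded through the index [k] of a function that is
    active at each point, since the slope is that of the active function. *)
Lemma relaxed_slope_finite_max (l : nat -> X -> R) (a : nat -> R) n :
  (forall k, S (l k) (cst (a k))) -> exists h g, [/\ S h g,
    forall x k, (k <= n)%N -> l k x <= h x &
    forall x, exists k, [/\ (k <= n)%N, h x = l k x & g x = a k]].
Proof.
move=> Sl; elim: n => [|n [h [g [Sh lh act]]]].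
  exists (l 0%N), (cst (a 0%N)); split => //.
    by move=> x k; rewrite leqn0 => /eqP ->.
  by move=> x; exists 0%N.
exists (fun x => Num.max (h x) (l n.+1 x)),
  (slope_min (\- h) g (\- l n.+1) (cst (a n.+1))); split.
- exact: relaxed_slope_max.
- move=> x k; rewrite leq_eqVlt => /predU1P[->|kn]; first by rewrite le_max lexx orbT.
  by rewrite le_max lh.
- move=> x; have [k [kn hk gk]] := act x.
  rewrite /slope_min /= !ltrN2.
  have [lt1|lt2|eq12] := ltgtP (l n.+1 x) (h x).
  + by exists k; split => //; rewrite ?leqW.
  + by exists n.+1.
  + have [le12|le21] := leP (g x) (a n.+1).
      by exists n.+1; split => //; rewrite ?eq12.
    by exists k; split => //; rewrite ?leqW// ?eq12.
Qed.

Lemma relaxed_slope_finite_min (h g : nat -> X -> R) n :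
  (forall i, S (h i) (g i)) -> exists F G, [/\ S F G,
    forall x i, (i <= n)%N -> F x <= h i x &
    forall x, exists i, [/\ (i <= n)%N, F x = h i x & G x = g i x]].
Proof.
move=> Sh; elim: n => [|n [F [G [SF Fh act]]]].
  exists (h 0%N), (g 0%N); split => //.
    by move=> x k; rewrite leqn0 => /eqP ->.
  by move=> x; exists 0%N.
exists (fun x => Num.min (F x) (h n.+1 x)), (slope_min F G (h n.+1) (g n.+1)); split.
- exact: relaxed_slope_min.
- move=> x k; rewrite leq_eqVlt => /predU1P[->|kn]; first by rewrite ge_min lexx orbT.
  by rewrite ge_min Fh.
- move=> x; have [k [kn hk gk]] := act x.
  rewrite /slope_min.
  have [lt1|lt2|eq12] := ltgtP (F x) (h n.+1 x).
  + by exists k; split => //; rewrite ?leqW.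
  + by exists n.+1.
  + have [le12|le21] := leP (G x) (g n.+1 x).
      by exists n.+1; split => //; rewrite ?eq12.
    by exists k; split => //; rewrite ?leqW// ?eq12.
Qed.

Variable y_ : nat -> X.
Hypothesis y_dense : forall x e, 0 < e -> exists i, mdist x (y_ i) < e.
Hypothesis y_slope : forall i, S (fun x => mdist x (y_ i)) (cst 1).

Variables (f : X -> R) (fb : Lip_b f) (M : R).
Hypotheses (M0 : 0 <= M) (fM : forall x y, `|f x - f y| <= M * mdist x y).

(** [Q] is the infimal convolution of [f] with [psi], the maximum over
    [k <= K] of the lines [s |-> k * dl * s - t * (2 ^+ k - 1)].  The line
    [k + 1] takes over from the line [k] at [s = t * 2 ^+ k / dl], so the active
    slope exceeds [psi s / s] by at most a fixed multiple of [dl].  Since the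
    steepest slope is larger than the Lipschitz constant of [f], almost optimal
    points are within [t * (2 ^+ K + 1)] of [x]. *)
Lemma hopf_lax_slope (dl t : R) (K : nat) :
  0 < dl -> 0 < t -> M + 1 <= K%:R * dl ->
  exists2 Q, (forall x, `|Q x - f x| <= t * 2 ^+ K) &
    S Q (fun x => Lip_ball f (t * (2 ^+ K + 1)) x + 3 * dl).
Proof.
move=> dl0 t0 KM.
pose b (k : nat) : R := t * (2 ^+ k - 1).
pose r := t * (2 ^+ K + 1).
have pow1 (k : nat) : 1 <= 2 ^+ k :> R by rewrite exprn_ege1// ler1n.
have r0 : 0 < r by rewrite mulr_gt0// ltr_wpDl// exprn_ge0.
have b0 k : 0 <= b k by rewrite mulr_ge0 ?subr_ge0// ltW.
pose l i (k : nat) x := (f (y_ i) - b k) + (k%:R * dl) * mdist x (y_ i).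
have Sl i k : S (l i k) (cst (k%:R * dl)).
  have := relaxed_slope_affine p_gt1 A_alg (f (y_ i) - b k) (k%:R * dl) (y_slope i).
  congr relaxed_slope; apply/funext => x /=.
  by rewrite mulr1 ger0_norm// mulr_ge0// ltW.
have /choice[hg hgP] : forall i, exists hg : (X -> R) * (X -> R), [/\ S hg.1 hg.2,
    forall x k, (k <= K)%N -> l i k x <= hg.1 x &
    forall x, exists k, [/\ (k <= K)%N, hg.1 x = l i k x & hg.2 x = k%:R * dl]].
  move=> i; have [h [g ?]] := relaxed_slope_finite_max K (Sl i).
  by exists (h, g).
pose h i := (hg i).1; pose g i := (hg i).2.
have Shg i : S (h i) (g i) by have [] := hgP i.
have /choice[FG FGP] : forall n, exists FG : (X -> R) * (X -> R), [/\ S FG.1 FG.2,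
    forall x i, (i <= n)%N -> FG.1 x <= h i x &
    forall x, exists i, [/\ (i <= n)%N, FG.1 x = h i x & FG.2 x = g i x]].
  move=> n; have [F [G ?]] := relaxed_slope_finite_min n Shg.
  by exists (F, G).
pose F n := (FG n).1; pose G n := (FG n).2.
have Fmono x : nonincreasing_seq (F ^~ x).
  move=> n1 n2 n12; have [_ F2 _] := FGP n2; have [_ _ /(_ x)[i [i1 F1 _]]] := FGP n1.
  by rewrite /F F1; apply: F2; exact: leq_trans n12.
(* The steepest line alone bounds [F n] from below. *)
have Flow n x : f x - b K <= F n x.
  have [_ _ /(_ x)[i [_ Fi _]]] := FGP n; rewrite /F Fi.
  have [_ /(_ x K (leqnn K)) lK _] := hgP i; apply: le_trans lK; rewrite /l.
  have := fM x (y_ i); rewrite ler_norml => /andP[_ fxy].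
  have : M * mdist x (y_ i) <= K%:R * dl * mdist x (y_ i).
    by rewrite ler_wpM2r ?mdist_ge0//; lra.
  by move: fxy; lra.
have Fup x : exists n0, forall n, (n0 <= n)%N -> F n x <= f x + t.
  have C0 : 0 < M + K%:R * dl by move: KM M0; lra.
  have [i xi] := y_dense x (divr_gt0 t0 C0).
  exists i => n ni; have [_ /(_ x i ni) Fi _] := FGP n; apply: le_trans Fi _.
  have [_ _ /(_ x)[k [kK hk _]]] := hgP i; rewrite /h hk /l.
  have := fM (y_ i) x; rewrite ler_norml metric_sym => /andP[_ fxy].
  have kd : k%:R * dl * mdist x (y_ i) <= K%:R * dl * mdist x (y_ i).
    by rewrite ler_wpM2r ?mdist_ge0// ler_wpM2r ?(ltW dl0)// ler_nat.
  have := b0 k; move: xi; rewrite ltr_pdivlMr// mulrC mulrDl.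
  move: fxy kd; lra.
have Gup n x : F n x <= f x + t -> G n x <= Lip_ball f r x + 3 * dl.
  have [_ _ /(_ x)[i [_ Fi Gi]]] := FGP n; rewrite /F /G Fi Gi.
  have [_ lh /(_ x)[k [kK hk gk]]] := hgP i; rewrite /g gk => hx.
  have L0 := Lip_ball_ge0 fb x r0.
  have [k2|k2] := leqP k 2.
    have : k%:R * dl <= 2 * dl by rewrite ler_pM2r// (ler_nat _ k 2).
    lra.
  set y := y_ i in hk lh *; set d := mdist x y.
  have d0 : 0 <= d by exact: mdist_ge0.
  have hkl k' : (k' <= K)%N -> f y - b k' + k'%:R * dl * d <= f x + t.
    by move=> /(lh x) h1; exact: le_trans h1 hx.
  case: k kK k2 hk gk => // k kK k2 hk gk.
  have kK' : (k <= K)%N by exact: ltnW.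
  (* The line [k] is below the active line [k + 1], hence
     [b k + t <= dl * d]; its own position then bounds [k * dl * d] by
     [(f x - f y) + b k + t], at most [Lip_ball f r x * d + dl * d]. *)
  have act := lh x k kK'; rewrite [X in _ <= X]hk /l -/y -/d in act.
  have kS : k.+1%:R * dl * d = k%:R * dl * d + dl * d by rewrite -natr1; ring.
  have bS : b k.+1 = 2 * b k + t by rewrite /b exprS; ring.
  have bk := b0 k.
  have dld : b k + t <= dl * d by move: act; rewrite kS bS; lra.
  have dpos : 0 < d.
    rewrite lt_neqAle d0 andbT; apply/eqP => d00; move: dld; rewrite -d00 mulr0; lra.
  (* The steepest line confines [y] to the ball of radius [r]. *)
  have dr : d < r.
    have fxy : f x - f y <= M * d.
      by apply: le_trans (fM x y); exact: ler_norm.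
    have := hkl K (leqnn K).
    have : (M + 1) * d <= K%:R * dl * d by rewrite ler_pM2r.
    have : r = b K + 2 * t by rewrite /r /b; ring.
    rewrite mulrDl mul1r; move: fxy; lra.
  have fxy : f x - f y <= Lip_ball f r x * d.
    apply: le_trans (ler_norm _) (Lip_ballP fb r0 (ballxx x r0) _).
    by rewrite ballEmdist.
  have hk' := hkl k kK'.
  by rewrite -(ler_pM2r dpos) kS; lra.
have Fcvg x : cvgn (F ^~ x).
  by apply: nonincreasing_is_cvgn => //; exists (f x - b K) => _ [n _ <-].
pose Q x := limn (F ^~ x).
have Qlow x : f x - b K <= Q x by apply: limr_ge => //; exact: nearW.
have Qup x : Q x <= f x + t.
  apply: limr_le => //; have [n0 n0P] := Fup x.
  by exists n0 => // n /= /n0P.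
exists Q.
  move=> x; have := Qlow x; have := Qup x; have := pow1 K.
  have : t * 1 <= t * 2 ^+ K by rewrite ler_pM2l.
  by rewrite /b mulrBr mulr1 ler_norml; lra.
pose B x := Lip_ball f r x + 3 * dl.
have Bm : measurableX B by apply: measurable_funD => //; exact: Lip_ball_measurable.
have B0 x : 0 <= B x.
  have := Lip_ball_ge0 fb x r0; rewrite /B; lra.
have BC x : B x <= M + 3 * dl by rewrite lerD2r; exact: Lip_ball_le.
have GK n x : 0 <= G n x <= K%:R * dl.
  have [_ _ /(_ x)[i [_ _ Gi]]] := FGP n; rewrite /G Gi.
  have [_ _ /(_ x)[k [kK _ gk]]] := hgP i; rewrite /g gk mulr_ge0 ?(ltW dl0)//=.
  by rewrite ler_pM2r// ler_nat.
pose C := (M + 3 * dl) + K%:R * dl.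
have SF n : S (F n) (G n) by have [] := FGP n.
have GL n : G n \in Lp by have [] := SF n.
have BL : B \in Lp.
  apply: (Lp_le p_gt1 Bm (Lp_cst m p (M + 3 * dl))) => x.
  by rewrite !ger0_norm//; apply: le_trans (B0 x) (BC x).
apply: (@relaxed_slope_bounded_cvg F (fun n x => Num.max (G n x) (B x)) Q B C) => //.
- move=> n; apply: relaxed_slope_le (SF n) _ _ => //; first exact: Lp_max.
  by apply: aeW => x; rewrite le_max lexx.
- have Fm n : measurableX (F n) by have [] := SF n.
  by apply: (measurable_fun_cvg Fm) => x _; exact: Fcvg.
- move=> n x; have /andP[g0 gK] := GK n x; have := BC x; have := B0 x.
  by rewrite ger0_norm ?le_max ?g0// ge_max /C => ? ?; apply/andP; split; lra.
- move=> x; have [n0 n0P] := Fup x.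
  apply: cvg_near_cst; exists n0 => // n /= /n0P nF.
  by apply: max_idPr; exact: Gup.
Qed.

(** The constants on balls of vanishing radius tend to [lip f]. *)
Lemma relaxed_slope_Lip_b : S f (lip f).
Proof.
have fm := Lip_b_measurable fb.
have lm := lip_measurable fb.
have inv_cvg : n.+1%:R^-1 @[n --> \oo] --> (0 : R) by exact: cvg_harmonic.
have lipM x : lip f x <= M by exact: lip_le_lipschitz.
have main dl : 0 < dl -> S f (fun x => lip f x + 3 * dl).
  move=> dl0; pose K := (Num.truncn ((M + 1) / dl)).+1.
  have KM : M + 1 <= K%:R * dl by rewrite -ler_pdivrMr// ltW// truncnS_gt.
  pose t (n : nat) : R := n.+1%:R^-1.
  have t0 n : 0 < t n by rewrite invr_gt0.
  have r0 n : 0 < t n * (2 ^+ K + 1) by rewrite mulr_gt0// ltr_wpDl// exprn_ge0.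
  have /choice[Q QP] : forall n, exists Q : X -> R,
      (forall x, `|Q x - f x| <= t n * 2 ^+ K) /\
      S Q (fun x => Lip_ball f (t n * (2 ^+ K + 1)) x + 3 * dl).
    by move=> n; have [Q Q1 Q2] := hopf_lax_slope dl0 (t0 n) KM; exists Q.
  apply: (@relaxed_slope_bounded_cvg Q
    (fun n x => Lip_ball f (t n * (2 ^+ K + 1)) x + 3 * dl) _ _ (M + 3 * dl)).
  - by move=> n; have [] := QP n.
  - by [].
  - exact: measurable_funD.
  - move=> n x; have L0 := Lip_ball_ge0 fb x (r0 n).
    rewrite ger0_norm; last by lra.
    by rewrite lerD2r; exact: Lip_ball_le.
  - move=> x; apply/cvgrPdist_le => e e0.
    have : t n * 2 ^+ K @[n --> \oo] --> 0.
      by rewrite -[X in _ --> X](mul0r (2 ^+ K)); apply: cvgM => //; exact: cvg_cst.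
    move=> /cvgr0Pnorm_le/(_ e e0); apply: filterS => n.
    rewrite distrC; have [/(_ x) Qx _] := QP n.
    by move=> /(le_trans (ler_norm _)); exact: le_trans.
  - move=> x; apply: cvgD; last exact: cvg_cst.
    apply: Lip_ball_cvg => //.
    by rewrite -[X in _ --> X](mul0r (2 ^+ K + 1)); apply: cvgM => //; exact: cvg_cst.
apply: (@relaxed_slope_bounded_cvg (fun=> f)
  (fun n x => lip f x + 3 * n.+1%:R^-1) _ _ (M + 3)) => //.
- by move=> n; apply: main; rewrite invr_gt0.
- move=> n x; have l0 := lip_ge0 x fb; have := lipM x.
  have i0 : 0 < n.+1%:R^-1 :> R by rewrite invr_gt0.
  have i1 : n.+1%:R^-1 <= 1 :> R by rewrite invf_le1// ler1n.
  move: (n.+1%:R^-1) i0 i1 => i i0 i1 lM.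
  by rewrite ger0_norm; lra.
- by move=> x; exact: cvg_cst.
- move=> x; rewrite -[X in _ --> X]addr0; apply: cvgD; first exact: cvg_cst.
  by rewrite -[X in _ --> X](mulr0 3); apply: cvgM => //; exact: cvg_cst.
Qed.

End hopf_lax.

(** * The density theorem *)

(** Approximate each term of a dense sequence by points of [Y] at all scales. *)
Lemma dense_separable_sequence {R : realType} {X : completeMetricType R}
    (Y : set X) : separable X -> dense Y -> exists y_ : nat -> X,
  (forall i, Y (y_ i)) /\
  forall x (e : R), 0 < e -> exists i, mdist x (y_ i) < e.
Proof.
move=> [D [Dc Dd]] Yd.
have near_dense (Z : set X) x (e : R) : dense Z -> 0 < e ->
    exists2 z, Z z & mdist x z < e.
  move=> Zd e0; have [||z [xz Zz]] := Zd (interior (ball x e)).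
  - by exists x; exact: nbhsx_ballx.
  - exact: open_interior.
  by exists z => //; have := interior_subset xz; rewrite ballEmdist.
have D0 : D !=set0 by have [z Dz _] := near_dense D point 1 Dd ltr01; exists z.
have [z_ zD] : exists z_ : nat -> X, D `<=` range z_.
  move: Dc => /pfcard_geP[D00|[z_]].
    by have [z] := D0; rewrite D00.
  by exists z_; exact: surj.
have /choice[y yP] : forall ik : nat * nat, exists y, Y y /\
    mdist (z_ ik.1) y < ik.2.+1%:R^-1.
  move=> [i k]; have k0 : 0 < k.+1%:R^-1 :> R by rewrite invr_gt0.
  have [y Yy zy] := near_dense Y (z_ i) _ Yd k0.
  by exists y.
exists (fun n => y (odflt (0%N, 0%N) (unpickle n))); split=> [n|x e e0].
  by have [] := yP (odflt (0%N, 0%N) (unpickle n)).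
have e2 : 0 < e / 2 by rewrite divr_gt0.
have [z Dz xz] := near_dense D x _ Dd e2.
have [i _ iz] := zD z Dz.
pose k := Num.truncn (e / 2)^-1.
exists (pickle (i, k)); rewrite pickleK /=.
have [_ /= zy] := yP (i, k); rewrite iz in zy.
have ke : k.+1%:R^-1 < e / 2.
  by rewrite -[ltRHS]invrK ltf_pV2 ?posrE ?invr_gt0// truncnS_gt.
apply: le_lt_trans (metric_triangle x z _) _.
by rewrite (splitr e) ltrD//; exact: lt_trans zy ke.
Qed.

Theorem theorem2p13 (R : realType) (X : completeMetricType R)
    (X_separable : separable X)
    (m : {finite_measure set (borel X) -> \bar R})
    (p : R) (p_gt1 : 1 < p)
    (Y : set X) (Y_dense : dense Y)
    (A : set (X -> R)) (A_alg : unital_subalgebra Lip_b A)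
    (A_sep : separates_points A)
    (A_dist : forall y, Y y ->
       D1p m p A (fun x => mdist x y) /\
       {ae m, forall x,
          minimal_relaxed_gradient m p A (fun z => mdist z y) x <= 1}) :
  dense_in_energy m p A.
Proof.
have AL : A `<=` Lip_b by case: A_alg.
have Alin (s t : R) f g : A f -> A g -> A (fun x => s * f x + t * g x).
  by have [_ _ AD AZ _] := A_alg => Af Ag; apply: (AD (s \*: f)); exact: AZ.
have Llin (s t : R) (f g : X -> R) : Lip_b f -> Lip_b g ->
    Lip_b (fun x => s * f x + t * g x).
  by move=> fb gb; apply: Lip_bD; exact: Lip_bZ.
have LL : @Lip_b R X `<=` Lip_b by [].
have dist_slope y : Y y -> relaxed_slope m p A (fun x => mdist x y) (cst 1).
  move=> /A_dist[[dm [G RG]] d1].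
  have SG := relaxed_gradient_slope p_gt1 AL Alin dm RG.
  have [_ [Sm _]] := minimal_relaxed_gradient_slope p_gt1 AL Alin SG.
  exact: relaxed_slope_le Sm (Lp_cst m p 1) d1.
have [y_ [yY y_dense]] := dense_separable_sequence X_separable Y_dense.
have y_slope i := dist_slope _ (yY i).
move=> f [fm [G RG]]; set Gm := minimal_relaxed_gradient m p Lip_b f.
have SG := relaxed_gradient_slope p_gt1 LL Llin fm RG.
have [_ [SGm Gm_min]] := minimal_relaxed_gradient_slope p_gt1 LL Llin SG.
have [_ GmL SGm_approx] := SGm.
have SAGm : relaxed_slope m p A f Gm.
  apply: relaxed_slope_closed => // e /SGm_approx[f' [g' [fb' g'L l' f'f g'G]]].
  have [M M0 fM] := Lip_b_lipschitz fb'.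
  exists f', g'; split => //.
  have Sl := relaxed_slope_Lip_b p_gt1 A_alg y_dense y_slope fb' M0 fM.
  by apply: relaxed_slope_le Sl g'L _ => //; exact: aeW.
have [f_ [G1 [Af ff lG1 SG1 G1_min]]] := minimal_slope_exists p_gt1 AL Alin SAGm.
have [_ G1L _] := SG1.
have G1Gm : Lpnorm m p (G1 \- Gm) = 0.
  apply: (minimal_slope_unique p_gt1 LL Llin) (Gm_min); last first.
  - by move=> k /Gm_min; apply: le_trans; exact: G1_min.
  - exact: SGm.
  - exact: relaxed_slope_sub SG1.
have fL n : lip (f_ n) \in Lfun m p%:E := lip_Lp m p_gt1 (AL _ (Af n)).
exists f_; split => //.
  by apply: L0dist_cvg_ae => // n; exact: Lip_b_measurable (AL _ (Af n)).
split => //.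
have dL n : (lip (f_ n) \- Gm) \in Lfun m p%:E by exact: LpB.
apply: (@cvg_trans _ ((fun n => (Lpnorm m p (lip (f_ n) \- Gm))%:E) @ \oo)).
  by apply: near_eq_cvg; apply: nearW => n; rewrite (LpnormE p_gt1 (dL n)).
apply/fine_cvgP; split; first exact: nearW.
apply: (@squeeze_cvgr _ _ _ _ (cst 0) (fun n => Lpnorm m p (lip (f_ n) \- G1))) => //.
  apply: nearW => n; rewrite Lpnorm_ge0/=.
  by have := Lpnorm_triangle p_gt1 (fL n) G1L GmL; rewrite G1Gm addr0.
exact: cvg_cst.
Qed.
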